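(* Let $p$ be a prime, and suppose that $A\subseteq\mathbb{F}_p$ satisfies $|A|<0.0045p$. If $|A-A|<2.6|A|-3$, then $A$ is contained in an arithmetic progression in $\mathbb{F}_p$ with at most $|A-A|-|A|+1$ terms.
   Context: $\mathbb{F}_p$ denotes the field (additive group) of prime order $p$. For $A,B$ subsets of an abelian group, $A-B=\{a-b: a\in A, b\in B\}$. *)

(* Defs.v *)
From mathcomp Require Export all_boot all_order all_algebra.

Set Implicit Arguments.
Unset Strict Implicit.
Unset Printing Implicit Defensive.

Import GRing.Theory.
Local Open Scope ring_scope.

Definition diffset (V : finZmodType) (A B : {set V}) : {set V} :=
  [set a - b | a in A, b in B].

Definition arith_prog (V : finZmodType) (a d : V) (n : nat) : {set V} :=
  [set a + d *+ i | i : 'I_n].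

(* Main.v *)
(** Let [n = #|A|], [D = A - A], [d = #|D|], and let [f x] be the number of
    representations of [x] as a difference of elements of [A].

    If, for some dilation, a half circle contains more than [(d + 3) / 3]
    elements of [A], these behave like a set of integers and the difference
    version of Freiman's [3k-4] theorem puts them in a short progression; any
    element of [A] far from it would create too many differences, so all of [A]
    lies in an interval and the integer theorem applies to [A] itself.

    Otherwise every nontrivial Fourier coefficient of [A] is at most
    [2 (d + 3) / 3 - n] in modulus, which bounds [W = \sum_x f x * (D o D) x]
    from above.  This contradicts two lower bounds: Katz-Koester with
    Cauchy-Davenport gives [W >= n^3 + \sum f^2 - n^2], and Cauchy-Schwarz on the
    triples [(c, c + u, c + v)] of [A] gives [d * W * \sum f^3 >= n^8]. *)
Require Import Defs.
From mathcomp Require Import all_boot all_order all_fingroup all_algebra cyclic.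
From mathcomp Require Import zify ring lra.
From mathcomp Require Import Rstruct reals trigo.

Set Implicit Arguments.
Unset Strict Implicit.
Unset Printing Implicit Defensive.
Import Order.TTheory GRing.Theory Num.Theory.
Local Open Scope ring_scope.

(* Canonical instances of a [finZmodType] reach a cardinal along different
   paths; [move:] identifies the resulting terms up to conversion, [lia] does
   not. *)
Ltac card_lia :=
  clear; repeat (match goal with |- context [@card.body ?T ?A] =>
    move: (@card.body T A) => ? end); lia.

(** * Difference sets in a finite abelian group *)

Section Diffset.
Variable V : finZmodType.
Implicit Types (A B X Y : {set V}) (a b x y z : V).

Lemma mem_diffset A B a b : a \in A -> b \in B -> a - b \in diffset A B.
Proof. exact: imset2_f. Qed.

Lemma diffsetP A B z :
  reflect (exists2 a, a \in A & exists2 b, b \in B & z = a - b)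
          (z \in diffset A B).
Proof.
apply: (iffP imset2P) => [[a b Aa Bb ->]|[a Aa [b Bb ->]]].
  by exists a => //; exists b.
by exists a b.
Qed.

Lemma diffsetS A B A' B' :
  A \subset A' -> B \subset B' -> diffset A B \subset diffset A' B'.
Proof. exact: imset2S. Qed.

Lemma sub_diffset0 A B : 0 \in B -> A \subset diffset A B.
Proof.
by move=> B0; apply/subsetP=> a Aa; rewrite -(subr0 a) mem_diffset.
Qed.

Lemma card_translate A x : #|[set a - x | a in A]| = #|A|.
Proof. by rewrite card_imset //; apply: addIr. Qed.

Lemma diffset_translate_l A B x :
  diffset [set a - x | a in A] B = [set z - x | z in diffset A B].
Proof.
apply/setP=> z; apply/diffsetP/imsetP.
  case=> _ /imsetP[a Aa ->] [b Bb ->].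
  by exists (a - b); [rewrite mem_diffset | rewrite addrAC].
case=> _ /diffsetP[a Aa [b Bb ->]] ->.
exists (a - x); first exact: imset_f.
by exists b; last rewrite addrAC.
Qed.

Lemma diffset_translate_r A B x :
  diffset A [set b - x | b in B] = [set z + x | z in diffset A B].
Proof.
apply/setP=> z; apply/diffsetP/imsetP.
  case=> a Aa [_ /imsetP[b Bb ->] ->].
  by exists (a - b); [rewrite mem_diffset | rewrite opprB addrCA addrC].
case=> _ /diffsetP[a Aa [b Bb ->]] ->.
exists a => //; exists (b - x); first exact: imset_f.
by rewrite opprB addrCA addrC.
Qed.

Lemma card_diffset_ge_r A B : A != set0 -> (#|B| <= #|diffset A B|)%N.
Proof.
case/set0Pn=> a Aa.
rewrite -(card_imset (mem B) (f := fun b => a - b)); last first.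
  by move=> x y /addrI/oppr_inj.
by apply/subset_leq_card/subsetP=> _ /imsetP[b Bb ->]; apply: mem_diffset.
Qed.

Lemma card_diffset_ge_l A B : B != set0 -> (#|A| <= #|diffset A B|)%N.
Proof.
case/set0Pn=> b Bb; rewrite -(card_translate A b).
by apply/subset_leq_card/subsetP=> _ /imsetP[a Aa ->]; apply: mem_diffset.
Qed.

(** Taking differences with [B] commutes with unions, whereas for intersections only an inclusion
    survives; inclusion-exclusion turns this into submodularity. *)
Lemma card_diffset_submod X Y B :
  (#|diffset (X :&: Y) B| + #|diffset (X :|: Y) B|
     <= #|diffset X B| + #|diffset Y B|)%N.
Proof.
have -> : diffset (X :|: Y) B = diffset X B :|: diffset Y B.
  apply/setP=> z; rewrite inE; apply/diffsetP/orP.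
    case=> a /setUP[Xa|Ya] [b Bb ->]; [left|right]; exact: mem_diffset.
  case=> /diffsetP[a Xa [b Bb ->]]; exists a; rewrite ?inE ?Xa ?orbT //;
    by exists b.
rewrite -[leqRHS]cardsUI addnC leq_add2l subset_leq_card //.
by rewrite subsetI !diffsetS // ?subsetIl ?subsetIr.
Qed.

(** If [y] is not in [X - B], then [y + b] is not in [X]. This duality turns a fragment [X] into the
    fragment [- (V \ (X - B))]. *)
Lemma subset_opp_compl_diffset X B :
  diffset [set - x | x in ~: diffset X B] B \subset [set - x | x in ~: X].
Proof.
apply/subsetP=> z /diffsetP[_ /imsetP[y nXy ->] [b Bb ->]].
apply/imsetP; exists (y + b); last by rewrite opprD.
rewrite inE; apply: contraL nXy => Xyb.
by rewrite inE negbK -(addrK b y) mem_diffset.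
Qed.

Lemma card_opp_compl X : #|[set - x | x in ~: X]| = (#|V| - #|X|)%N.
Proof.
rewrite card_imset; last exact: oppr_inj.
by rewrite -(cardsC X) addKn.
Qed.

End Diffset.

(** * Atoms and the Cauchy-Davenport inequality *)

(* A set [X] with [X - B <> V] and [#|X - B| - #|X|] minimal is a fragment; a
   smallest fragment is an atom.  By submodularity two atoms that meet
   coincide, so the atom through [0] is stable under its own translations. *)
Lemma atom_subgroup (V : finZmodType) (B : {set V}) :
  0 \in B -> B != setT ->
  exists H : {set V}, [/\ 0 \in H, {in H &, forall x y, x - y \in H},
    diffset H B != setT
  & forall X : {set V}, X != set0 -> diffset X B != setT ->
      (#|X| + #|diffset H B| <= #|diffset X B| + #|H|)%N].
Proof.
move=> B0 BnT.
pose good (X : {set V}) := (X != set0) && (diffset X B != setT).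
pose ex (X : {set V}) := (#|diffset X B| - #|X|)%N.
have exE X : #|diffset X B| = (ex X + #|X|)%N.
  by rewrite subnK // subset_leq_card // sub_diffset0.
have g0 : good [set 0].
  rewrite /good -cards_eq0 cards1 /=; apply: contra BnT => /eqP e.
  apply/eqP/setP=> x; rewrite inE.
  have : - x \in diffset [set 0] B by rewrite e inE.
  by case/diffsetP=> a /set1P-> [b Bb]; rewrite sub0r => /oppr_inj->.
case: (@arg_minnP _ [set 0] good ex g0) => X0 gX0 minX0.
pose frag X := good X && (ex X == ex X0).
have fX0 : frag X0 by rewrite /frag gX0 eqxx.
case: (@arg_minnP _ X0 frag (fun X => #|X|) fX0) => M0 fM0 minM0.
have /andP[/andP[/set0Pn[m0 M0m0] M0T] /eqP exM0] := fM0.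
have fragT M x : frag M -> frag [set a - x | a in M].
  rewrite /frag /good /ex diffset_translate_l.
  rewrite -!cards_eq0 !card_translate.
  move=> /andP[/andP[-> h2] ->]; rewrite andbT /=.
  apply: contra h2 => /eqP e; rewrite eqEcard subsetT /=.
  by rewrite -(card_translate (diffset M B) x) e.
pose M := [set a - m0 | a in M0].
have fM : frag M by exact: fragT.
have cM : #|M| = #|M0| by rewrite card_translate.
have M0' : 0 \in M by apply/imsetP; exists m0; rewrite ?subrr.
(* The dual [Y] of [M] is again a fragment, with [#|V| - ex X0 - #|M|] elements, and an atom is no
   larger than any fragment. *)
have room : (ex X0 + 2 * #|M| <= #|V|)%N.
  have [/andP[Mn MT] /eqP eM] := andP fM.
  pose Y := [set - x | x in ~: diffset M B].
  have cY : (#|Y| = #|V| - #|diffset M B|)%N.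
    exact: card_opp_compl.
  have sY : (#|diffset Y B| <= #|V| - #|M|)%N.
    apply: leq_trans (subset_leq_card (subset_opp_compl_diffset _ _)) _.
    by rewrite card_opp_compl.
  have lMB : (#|diffset M B| <= #|V|)%N by exact: max_card.
  have lM : (#|M| <= #|V|)%N by exact: max_card.
  have Mpos : (0 < #|M|)%N by rewrite card_gt0.
  have MBT : (#|diffset M B| < #|V|)%N.
    rewrite ltn_neqAle lMB andbT; apply: contra MT => /eqP e.
    by rewrite eqEcard subsetT cardsT e /=.
  have gY : good Y.
    rewrite /good -cards_eq0 cY; apply/andP; split.
      by rewrite -lt0n subn_gt0.
    apply: contraTneq sY => ->; rewrite cardsT -ltnNge.
    by rewrite ltn_subrL Mpos (leq_trans Mpos).
  have fY : frag Y.
    rewrite /frag gY eqn_leq minX0 // andbT -eM /ex cY.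
    by move: sY lMB lM MBT; card_lia.
  have := minM0 _ fY; rewrite -cM cY exE eM.
  by move: lMB; rewrite exE eM; card_lia.
(* By submodularity, once [N :|: M] is known to be good, [N :&: M] is a fragment, so minimality
   makes it equal to both atoms. *)
have meet N : frag N -> #|N| = #|M| -> 0 \in N -> N = M.
  move=> fN cN N0.
  have [/andP[Nn NT] /eqP eN] := andP fN.
  have [/andP[Mn MT] /eqP eM] := andP fM.
  have sub := card_diffset_submod N M B.
  have cUI := cardsUI N M.
  have I0 : 0 \in N :&: M by rewrite inE N0.
  have Ipos : (0 < #|N :&: M|)%N by rewrite card_gt0; apply/set0Pn; exists 0.
  have gI : good (N :&: M).
    rewrite /good -card_gt0 Ipos /=; apply: contra NT => /eqP e.
    by rewrite -subTset -e diffsetS ?subsetIl.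
  have exI := minX0 _ gI.
  have gU : good (N :|: M).
    rewrite /good -card_gt0; apply/andP; split.
      by apply: leq_trans Ipos (subset_leq_card _); rewrite subIset ?subsetUl.
    (* If the union had all of [V] as difference set, submodularity would give
       [#|V| + #|N :&: M| <= ex X0 + 2 * #|M|], against [room]. *)
    apply/eqP=> e; move: sub exI room; rewrite e cardsT !exE eN eM cN.
    by move: Ipos; card_lia.
  have exU := minX0 _ gU.
  have fI : frag (N :&: M).
    rewrite /frag gI eqn_leq exI andbT.
    by move: sub exU cUI; rewrite !exE eN eM; card_lia.
  have := minM0 _ fI; rewrite -cM => cI.
  have e1 : N :&: M = M by apply/eqP; rewrite eqEcard subsetIr cI.
  have e2 : N :&: M = N by apply/eqP; rewrite eqEcard subsetIl cN cI.
  by rewrite -e2 e1.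
have [/andP[Mn MT] /eqP eM] := andP fM.
exists M; split=> // [x y Mx My|X Xn XT].
  have e : [set a - y | a in M] = M.
    apply: meet; [exact: fragT | exact: card_translate |].
    by apply/imsetP; exists y; rewrite ?subrr.
  suff: x - y \in [set a - y | a in M] by rewrite e.
  exact: imset_f.
have gX : good X by rewrite /good Xn.
have := minX0 _ gX; rewrite !exE eM; card_lia.
Qed.

(** After translating [B] to contain 0, the atom [H] is a subgroup of a group of prime order. It is
    not [V], so it is trivial, and then [H - B] has at least [#|B|] elements. *)
Lemma cauchy_davenport_diff (V : finZmodType) (A B : {set V}) :
  prime #|V| -> A != set0 -> B != set0 -> diffset A B != setT ->
  (#|A| + #|B| <= #|diffset A B| + 1)%N.
Proof.
move=> pV An /set0Pn[b0 Bb0] DT.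
pose B' := [set b - b0 | b in B].
have cB : #|B'| = #|B| by rewrite card_translate.
have D' : diffset A B' = [set z + b0 | z in diffset A B].
  exact: diffset_translate_r.
have cD : #|diffset A B'| = #|diffset A B|.
  by rewrite D' card_imset //; apply: addIr.
have B0 : 0 \in B' by apply/imsetP; exists b0; rewrite ?subrr.
have DT' : diffset A B' != setT.
  by apply: contra DT => /eqP e; rewrite eqEcard subsetT -cD e /=.
have BT : B' != setT.
  apply: contra DT' => /eqP e.
  rewrite eqEcard subsetT /= -[X in (#|pred_of_set X| <= _)%N]e.
  exact: card_diffset_ge_r.
have [H [H0 Hs HT Hmin]] := atom_subgroup B0 BT.
have dvdH : (#|H| %| #|V|)%N.
  have gH : group_set (H : {set V}).
    apply/group_setP; split=> // x y Hx Hy.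
    have : x - (0 - y) \in H by rewrite !Hs.
    by rewrite sub0r opprK.
  by have := cardSg (subsetT (Group gH)); rewrite cardsT.
have := Hmin _ An DT'; rewrite cD -cB.
case/primeP: pV => _ /(_ _ dvdH)/orP[/eqP h1|/eqP hV].
  have : (#|B'| <= #|diffset H B'|)%N.
    by apply: card_diffset_ge_r; apply/set0Pn; exists 0.
  by rewrite h1; card_lia.
case/eqP: HT; apply/eqP; rewrite eqEcard subsetT /= cardsT -hV.
by apply: card_diffset_ge_l; apply/set0Pn; exists 0.
Qed.

(** * Integer difference sets and reduction modulo the largest element *)

Lemma inZpD (l x y : nat) : (inZp (x + y) : 'I_l.+1) = inZp x + inZp y.
Proof. by apply: val_inj; rewrite /= modnDm. Qed.

Lemma inZp_self (l : nat) : (inZp l.+1 : 'I_l.+1) = 0.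
Proof. by apply: val_inj; rewrite /= modnn. Qed.

(** The witness is the least positive integer with residue in [K], which exists because [l.+1]
    represents 0. Division with remainder gives divisibility, and the value 1 would make [K]
    everything. *)
Lemma proper_subgroup_multiples (l : nat) (K : {set 'I_l.+1}) :
  0 \in K -> {in K &, forall x y, x - y \in K} -> K != setT ->
  exists2 m : nat, (1 < m)%N & forall x : nat, inZp x \in K -> (m %| x)%N.
Proof.
move=> K0 Ks KT.
have exm : exists m, (0 < m)%N && (inZp m \in K).
  by exists l.+1; rewrite inZp_self K0.
case: (ex_minnP exm) => m /andP[m0 Km] minm.
have KN x : x \in K -> - x \in K by move=> Kx; rewrite -sub0r Ks.
have Kmul q : inZp (q * m) \in K.
  elim: q => [|q IH]; first by rewrite mul0n (_ : inZp 0 = 0) //; apply: val_inj.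
  by rewrite mulSn inZpD -[inZp (q * m)]opprK Ks // KN.
have dvd x : inZp x \in K -> (m %| x)%N.
  move=> Kx; rewrite /dvdn; apply: contraT => nz.
  have Kr : inZp (x %% m) \in K.
    have -> : (inZp (x %% m) : 'I_l.+1) = inZp x - inZp (x %/ m * m).
      by rewrite {2}(divn_eq x m) inZpD addrC addKr.
    by rewrite Ks.
  have := minm (x %% m)%N; rewrite Kr lt0n nz => /(_ isT).
  by rewrite leqNgt ltn_pmod.
exists m => //; rewrite ltn_neqAle m0 andbT; apply: contra KT => /eqP m1.
apply/eqP/setP=> x; rewrite inE; have := Kmul x.
by rewrite -m1 muln1 valZpK.
Qed.

Section IntegerDifferences.
Variable l : nat.
Implicit Types (X Y S : {set 'I_l.+2}).

(* The difference [x - y] in [-l-1, l+1] is encoded as [x + (l+1) - y]. *)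
Definition shifted_diff (x y : 'I_l.+2) : 'I_(l.+1 + l.+1).+1 :=
  inord (x + l.+1 - y).

Lemma shifted_diffE x y : shifted_diff x y = (x + l.+1 - y)%N :> nat.
Proof.
rewrite inordK //; have := ltn_ord x; have := ltn_ord y; card_lia.
Qed.

Definition shifted_diffset X Y : {set 'I_(l.+1 + l.+1).+1} :=
  [set shifted_diff x y | x in X, y in Y].

(** The differences [x - min Y] and [min X - y] lie on either side of [min X - min Y], the only
    value they share. *)
Lemma card_shifted_diffset_ge X Y : X != set0 -> Y != set0 ->
  (#|X| + #|Y| <= #|shifted_diffset X Y| + 1)%N.
Proof.
case/set0Pn=> x1 Xx1 /set0Pn[y1 Yy1].
case: (@arg_minnP _ x1 (mem X) val Xx1) => x0 /= Xx0 minx.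
case: (@arg_minnP _ y1 (mem Y) val Yy1) => y0 /= Yy0 miny.
pose U := [set shifted_diff x y0 | x in X].
pose W := [set shifted_diff x0 y | y in Y].
have cU : #|U| = #|X|.
  rewrite card_imset // => x x' /(congr1 val) /=; rewrite !shifted_diffE => e.
  by apply: ord_inj; move: e (ltn_ord y0); card_lia.
have cW : #|W| = #|Y|.
  rewrite card_imset // => x x' /(congr1 val) /=; rewrite !shifted_diffE => e.
  by apply: ord_inj; move: e (ltn_ord x) (ltn_ord x'); card_lia.
have sU : U :|: W \subset shifted_diffset X Y.
  by apply/subsetP=> z /setUP[] /imsetP[t Tt ->]; apply: imset2_f.
have sI : U :&: W \subset [set shifted_diff x0 y0].
  apply/subsetP=> z /setIP[/imsetP[x Xx ->] /imsetP[y Yy e]].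
  move/(congr1 val): (e); rewrite /= !shifted_diffE => e'.
  rewrite inE; apply/eqP/val_inj; rewrite /= !shifted_diffE.
  move: (minx _ Xx) (miny _ Yy) e' (ltn_ord y) (ltn_ord y0); card_lia.
have := subset_leq_card sI; rewrite cards1 => le1.
have := subset_leq_card sU; have := cardsUI U W.
by rewrite -cU -cW; move: le1; card_lia.
Qed.

(** The differences [x - 0] form a set [T] of size [#|S|] with residues in [B], hence outside [Q].
    Each residue of [B - B] outside [Q] also comes from a difference not in [T]: any representative
    if the residue is not in [B], and the negative difference [x - (l+1)] if it is. *)
Lemma card_shifted_diffset_avoid S (Q : {set 'I_l.+1})
    (B := [set (inZp (val x) : 'I_l.+1) | x in S]) :
  ord0 \in S -> ord_max \in S -> [disjoint Q & B] ->
  (#|S| + #|diffset B B :\: Q|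
     <= #|[set z in shifted_diffset S S | inZp (val z) \notin Q]|)%N.
Proof.
move=> S0 Sl dQB.
set D2 := [set z in _ | _].
pose T := [set shifted_diff x ord0 | x in S].
have cT : #|T| = #|S|.
  rewrite card_imset // => x x' /(congr1 val) /=; rewrite !shifted_diffE /= => e.
  by apply: ord_inj; move: e; card_lia.
have pr x y :
    (inZp (val (shifted_diff x y)) : 'I_l.+1) = inZp (val x) - inZp (val y).
  apply/eqP; rewrite eq_sym subr_eq -inZpD /= shifted_diffE subnK.
    by rewrite inZpD inZp_self addr0.
  by move: (ltn_ord y); card_lia.
have z0 : (inZp 0 : 'I_l.+1) = 0 by apply: val_inj.
have BQ b : b \in B -> b \notin Q.
  by move=> Bb; rewrite (disjointFl dQB Bb).
have sT : T \subset D2.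
  apply/subsetP=> _ /imsetP[x Sx ->]; rewrite inE imset2_f //= pr z0 subr0.
  by rewrite BQ // imset_f.
have sR : diffset B B :\: Q \subset [set inZp (val z) | z in D2 :\: T].
  apply/subsetP=> r /setDP[/diffsetP[b Bb [b' Bb' rE]] rQ].
  have [/imsetP[x Sx rx]|rB] := boolP (r \in B).
    (* Residue 0 comes from both 0 and [l.+1]; choosing 0 keeps [x - (l+1)] strictly negative. *)
    wlog xl : x Sx rx / (x < l.+1)%N.
      have [xl|xl] := ltnP x l.+1; first by move=> W; exact: (W x).
      have xE : x = ord_max by apply: ord_inj; move: xl (ltn_ord x) => /=; card_lia.
      by move=> W; apply: (W ord0) => //; rewrite rx xE /= inZp_self z0.
    apply/imsetP; exists (shifted_diff x ord_max).
      rewrite inE; apply/andP; split; last first.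
        by rewrite inE imset2_f //= pr /= inZp_self subr0 -rx.
      apply/imsetP=> -[y Sy /(congr1 val)] /=; rewrite !shifted_diffE /=.
      by move: xl; card_lia.
    by rewrite pr /= inZp_self subr0.
  move: Bb Bb' rE => /imsetP[x Sx ->] /imsetP[y Sy ->] rE.
  apply/imsetP; exists (shifted_diff x y); rewrite ?pr //.
  rewrite 2!inE imset2_f //= pr -rE rQ andbT.
  apply/imsetP=> -[t St e]; case/negP: rB; rewrite rE -pr e pr z0 subr0.
  exact: imset_f.
have le1 : (#|diffset B B :\: Q| <= #|D2 :\: T|)%N.
  exact: leq_trans (subset_leq_card sR) (leq_imset_card _ _).
have := cardsID T D2; rewrite (setIidPr sT) cT.
by move: le1; card_lia.
Qed.

(* The difference analogue of Freiman's [3k-4] theorem, proved by the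
   Lev-Smeliansky reduction modulo the largest element. *)
Lemma freiman_shifted_diffset S :
  ord0 \in S -> ord_max \in S ->
  (forall m : nat, (1 < m)%N -> exists2 x, x \in S & ~~ (m %| val x)%N) ->
  (l.+1 + #|S| <= #|shifted_diffset S S|)%N
  \/ (3 * #|S| <= #|shifted_diffset S S| + 3)%N.
Proof.
move=> S0 Sl gcd1.
pose pi (x : nat) : 'I_l.+1 := inZp x.
pose B := [set pi (val x) | x in S].
have z0 : pi 0%N = 0 by apply: val_inj.
have B0 : 0 \in B by apply/imsetP; exists ord0.
have cB : (#|S| <= #|B| + 1)%N.
  have e : [set pi (val x) | x in S :\ ord_max] \subset B.
    by apply: imsetS; apply: subsetDl.
  have := subset_leq_card e; rewrite card_in_imset.
    by rewrite (cardsD1 ord_max S) Sl; card_lia.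
  move=> x y /setD1P[nx _] /setD1P[ny _] /(congr1 val) /= exy.
  apply: ord_inj; move: exy; rewrite !modn_small //.
    by move: ny (ltn_ord y); rewrite -val_eqE /=; card_lia.
  by move: nx (ltn_ord x); rewrite -val_eqE /=; card_lia.
have [RT|RT] := eqVneq (diffset B B) setT.
  left; have := @card_shifted_diffset_avoid S set0 S0 Sl.
  rewrite disjoint_sym disjoints_subset setC0 subsetT => /(_ isT).
  rewrite RT setD0 cardsT card_ord addnC => /leq_trans; apply.
  by apply/subset_leq_card/subsetP=> z; rewrite inE => /andP[].
right.
have BT : B != setT.
  apply: contra RT => /eqP e; apply/eqP/setP=> x; rewrite [RHS]inE.
  by apply: (subsetP (sub_diffset0 B B0)); rewrite e inE.
have [H [H0 Hs HT Hmin]] := atom_subgroup B0 BT.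
have HN x : x \in H -> - x \in H by move=> Hx; rewrite -sub0r Hs.
have HD x y : x \in H -> y \in H -> x + y \in H.
  by move=> Hx Hy; rewrite -[y]opprK Hs // HN.
have Bn : B != set0 by apply/set0Pn; exists 0.
have := Hmin B Bn RT.
pose K := diffset B H.
have cK : #|diffset H B| = #|K|.
  rewrite -(card_imset (mem K) (@oppr_inj _)); congr #|pred_of_set _|.
  apply/setP=> z; apply/diffsetP/imsetP.
    case=> h Hh [b Bb ->]; exists (b - h); rewrite ?mem_diffset //.
    by rewrite opprB.
  case=> _ /diffsetP[b Bb [h Hh ->]] ->; exists h => //; exists b => //.
  by rewrite opprB.
rewrite cK => Rge.
have KT : K != setT.
  by apply: contra HT => /eqP e; rewrite eqEcard subsetT cK e /=.
have sBK : B \subset K by apply: sub_diffset0.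
(* If every difference of [B] fell in [K = B + H], then [K] would be a proper subgroup containing
   [B], and all of [S] would share a common divisor. *)
have [/existsP[c /existsP[c' /and3P[Bc Bc' cc']]]|nex] :=
    boolP [exists c, exists c', [&& c \in B, c' \in B & c - c' \notin K]];
    last first.
  have Ks : {in K &, forall x y, x - y \in K}.
    move=> x y /diffsetP[b Bb [h Hh ->]] /diffsetP[b' Bb' [h' Hh' ->]].
    have : b - b' \in K.
      apply: contraR nex => nK; apply/existsP; exists b; apply/existsP; exists b'.
      by rewrite Bb Bb'.
    case/diffsetP=> b2 Bb2 [h2 Hh2 e].
    have -> : b - h - (b' - h') = b2 - (h2 + (h - h')).
      rewrite [in RHS]opprD [RHS]addrA -e !opprB addrACA [RHS]addrACA.
      by rewrite [- h - b']addrC.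
    by rewrite mem_diffset // HD // Hs.
  have [m m1 dvdm] := proper_subgroup_multiples (subsetP sBK _ B0) Ks KT.
  have [x Sx] := gcd1 m m1.
  by rewrite dvdm // (subsetP sBK) // imset_f.
(* The coset [Q] of [c - c'] misses [B]. Differences with residue outside [Q] are counted by the
   previous lemma; those inside are bounded below by integer differences between the parts of [S]
   over the cosets of [c] and [c']. *)
pose Q := [set g | g - (c - c') \in H].
pose C (a : 'I_l.+1) := [set g | g - a \in H].
have cC a : #|C a| = #|H|.
  rewrite -(card_imset (mem H) (@addIr _ a)); congr #|pred_of_set _|.
  apply/setP=> g; rewrite inE; apply/idP/imsetP.
    by move=> h; exists (g - a); rewrite ?subrK.
  by case=> h Hh ->; rewrite addrK.
have dQB : [disjoint Q & B].
  apply/pred0P=> b /=; apply/negP=> /andP[]; rewrite inE => h Bb.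
  case/negP: cc'; have -> : c - c' = b - (b - (c - c')) by rewrite subKr.
  exact: mem_diffset.
have := card_shifted_diffset_avoid S0 Sl dQB.
rewrite -/B; set D2 := [set z in _ | _] => D2ge.
pose A a := [set x in S | pi (val x) \in C a].
have An a : a \in B -> A a != set0.
  case/imsetP=> x Sx ->; apply/set0Pn; exists x.
  by rewrite !inE Sx subrr.
have D1ge := card_shifted_diffset_ge (An _ Bc) (An _ Bc').
pose D1 := [set z in shifted_diffset S S | inZp (val z) \in Q].
have sD1 : shifted_diffset (A c) (A c') \subset D1.
  apply/subsetP=> _ /imset2P[x y Ax Ay ->].
  move: Ax Ay; rewrite !inE => /andP[Sx hx] /andP[Sy hy].
  rewrite imset2_f //=.
  have -> : (inZp (shifted_diff x y) : 'I_l.+1) = pi (val x) - pi (val y).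
    apply/eqP; rewrite eq_sym subr_eq -inZpD /= shifted_diffE subnK.
      by rewrite /pi inZpD inZp_self addr0.
    by move: (ltn_ord y); card_lia.
  have -> : pi (val x) - pi (val y) - (c - c') = pi (val x) - c - (pi (val y) - c').
    by rewrite !opprB addrACA [RHS]addrACA [- c - _]addrC.
  exact: Hs.
have cD : (#|D1| + #|D2|)%N = #|shifted_diffset S S|.
  rewrite -[RHS](cardsID
    [set z : 'I_(l.+1 + l.+1).+1 | (inZp (val z) : 'I_l.+1) \in Q]).
  congr (_ + _)%N; apply: eq_card => z; rewrite !inE //.
  by rewrite andbC.
have cA a : (#|B :&: C a| <= #|A a|)%N.
  apply: leq_trans (leq_imset_card (fun x : 'I_l.+2 => pi (val x)) _).
  apply/subset_leq_card/subsetP=> _ /setIP[/imsetP[x Sx ->] h].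
  by apply: imset_f; rewrite inE Sx.
have sCK a : a \in B -> C a \subset K.
  move=> Ba; apply/subsetP=> g; rewrite inE => h.
  have -> : g = a - - (g - a) by rewrite opprK addrC subrK.
  by rewrite mem_diffset // HN.
have dC : C c :&: C c' = set0.
  apply/setP=> g; rewrite !inE; apply/negP=> /andP[h h'].
  case/negP: cc'; have -> : c - c' = 0 - ((g - c) - (g - c')).
    by rewrite sub0r !opprB [RHS]addrC [RHS]addrA subrK.
  by rewrite mem_diffset // Hs.
(* The two cosets are disjoint subsets of [K], so together they contain at most [#|K| - #|B|] points
   outside [B]. *)
have BK : (#|B| + 2 * #|H| <= #|B :&: C c| + #|B :&: C c'| + #|K|)%N.
  have e1 : (#|B :&: C c| + #|B :&: C c'|)%N = #|B :&: (C c :|: C c')|.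
    by rewrite setIUr -cardsUI -setIIr dC setI0 cards0 addn0.
  have e2 : #|C c :|: C c'| = (2 * #|H|)%N.
    have := cardsUI (C c) (C c'); rewrite dC cards0 !cC addn0 => ->.
    by card_lia.
  rewrite e1 -e2 -cardsUI setIC.
  rewrite [leqRHS]addnC [leqLHS]addnC addnC leq_add2r.
  by rewrite subset_leq_card // !subUset sBK !sCK.
have RQ : (#|diffset B B| <= #|diffset B B :\: Q| + #|H|)%N.
  rewrite -(cardsID Q (diffset B B)) addnC leq_add2l.
  by rewrite -(cC (c - c')) subset_leq_card // subsetIr.
(* The sizes of [H] and [K] cancel, leaving [#|S| + 2 * #|B| - 1], which is at least
   [3 * #|S| - 3]. *)
move: (subset_leq_card sD1) (cA c) (cA c') BK RQ D2ge D1ge Rge cB.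
by rewrite -cD; card_lia.
Qed.

End IntegerDifferences.

(** * Progressions in a group of prime order and rectification to integers *)

Section PrimeOrder.
Variable V : finZmodType.
Hypothesis prime_V : prime #|V|.
Implicit Types (A S : {set V}) (a e x : V).

Lemma order_prime_card e : e != 0 -> #[e]%g = #|V|.
Proof.
move=> e0; have := order_dvdG (in_setT e); rewrite cardsT.
case/primeP: prime_V => _ h /h/orP[|/eqP//].
by rewrite order_eq1 => /eqP e1; case/eqP: e0.
Qed.

Lemma mulrn_modV e i : e *+ (i %% #|V|) = e *+ i.
Proof.
have [->|e0] := eqVneq e 0; first by rewrite !mul0rn.
by rewrite -!FinRing.zmodXgE -(order_prime_card e0) expg_mod_order.
Qed.

Lemma mulrn_injV e i j :
  e != 0 -> (i < #|V|)%N -> (j < #|V|)%N -> e *+ i = e *+ j -> i = j.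
Proof.
move=> e0 ip jp /eqP; rewrite -!FinRing.zmodXgE eq_expg_mod_order order_prime_card //.
by rewrite !modn_small // => /eqP.
Qed.

Lemma mulrn_surjV e x : e != 0 -> exists2 i, (i < #|V|)%N & x = e *+ i.
Proof.
move=> e0; have xe : x \in <[e]>%g.
  suff -> : <[e]>%g = [set: V] by rewrite inE.
  by apply/eqP; rewrite eqEcard subsetT cardsT -(order_prime_card e0) /=.
have [i _ ->] := cyclePmin xe.
by exists (i %% #|V|)%N; rewrite ?ltn_pmod ?prime_gt0 // mulrn_modV FinRing.zmodXgE.
Qed.

Lemma mulrn_neq0V e i : e != 0 -> (0 < i < #|V|)%N -> e *+ i != 0.
Proof.
move=> e0 /andP[i0 ip]; apply/eqP => h.
have := @mulrn_injV e i 0 e0 ip (prime_gt0 prime_V); rewrite mulr0n h.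
by move=> /(_ erefl) i00; rewrite i00 in i0.
Qed.

Lemma arith_progP a e n x :
  reflect (exists2 i, (i < n)%N & x = a + e *+ i) (x \in arith_prog a e n).
Proof.
apply: (iffP imsetP) => [[i _ ->]|[i lt_in ->]]; first by exists i.
by exists (Ordinal lt_in).
Qed.

Lemma arith_progS a e m n :
  (m <= n)%N -> arith_prog a e m \subset arith_prog a e n.
Proof.
move=> mn; apply/subsetP=> x /arith_progP[i im ->].
by apply/arith_progP; exists i => //; apply: leq_trans mn.
Qed.

(** Induction on [L] drops an end of the progression that is not in [S], or enlarges the step when
    all indices share a divisor. Once neither is possible, the integer theorem applies to the
    indices: [2 * L < #|V|] keeps distinct integer differences distinct in [V]. *)
Lemma freiman_in_short_prog S a e L :
  e != 0 -> (2 * L < #|V|)%N -> S \subset arith_prog a e L.+1 ->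
  (#|diffset S S| + 3 < 3 * #|S|)%N ->
  exists a' e', e' != 0 /\ S \subset arith_prog a' e' (#|diffset S S| - #|S|).+1.
Proof.
elim/ltn_ind: L a e => -[|m] IH a e e0 Lp sS small.
  have : (#|S| <= 1)%N.
    apply: leq_trans (subset_leq_card sS) _.
    by apply: leq_trans (leq_imset_card _ _) _; rewrite card_ord.
  have : (0 < #|diffset S S|)%N || (#|S| == 0)%N.
    have [/eqP|Sn] := posnP #|S|; first by rewrite orbT.
    by rewrite (leq_trans Sn) // card_diffset_ge_l // -card_gt0.
  move: small; card_lia.
pose phi (j : 'I_m.+2) := a + e *+ val j.
pose S' := [set j | phi j \in S].
have phi_inj : injective phi.
  move=> i j /addrI h; apply: ord_inj; apply: (mulrn_injV e0 _ _ h).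
    by move: Lp (ltn_ord i) => /=; card_lia.
  by move: Lp (ltn_ord j) => /=; card_lia.
have SE : S = [set phi j | j in S'].
  apply/setP=> x; apply/idP/imsetP=> [Sx|[j]]; last by rewrite inE => ? ->.
  have /arith_progP[i im xE] := subsetP sS _ Sx.
  by exists (Ordinal im); rewrite ?inE /phi -?xE.
have cS : #|S'| = #|S| by rewrite [in RHS]SE card_imset.
have [S0|nS0] := boolP (ord0 \in S'); last first.
  apply: (IH m _ (a + e) e) => //; first by move: Lp; card_lia.
  apply/subsetP=> x Sx; have /arith_progP[[|i] im xE] := subsetP sS _ Sx.
    by move: nS0; rewrite inE /phi /= -xE Sx.
  by apply/arith_progP; exists i => //; rewrite xE mulrS addrA.
have [Sm|nSm] := boolP (ord_max \in S'); last first.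
  apply: (IH m _ a e) => //; first by move: Lp; card_lia.
  apply/subsetP=> x Sx; have /arith_progP[i im xE] := subsetP sS _ Sx.
  apply/arith_progP; exists i => //; rewrite ltn_neqAle -ltnS im andbT.
  by apply: contra nSm => /eqP iE; rewrite inE /phi /= -iE -xE.
have [/forallP gcd1|] := boolP
    [forall k : 'I_m.+2, (1 < k)%N ==> [exists x in S', ~~ (k %| val x)%N]];
    last first.
  rewrite negb_forall => /existsP[k]; rewrite negb_imply negb_exists.
  case/andP=> k1 /forallP kS.
  have kdvd (x : 'I_m.+2) : x \in S' -> (k %| val x)%N.
    by move=> Sx; have := kS x; rewrite Sx /= negbK.
  apply: (IH (m.+1 %/ k)%N _ a (e *+ k)) => //.
  - by rewrite ltn_Pdiv.
  - by apply: mulrn_neq0V => //; move: k1 (ltn_ord k) Lp; card_lia.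
  - by apply: leq_ltn_trans Lp; rewrite leq_mul2l leq_div.
  apply/subsetP=> x; rewrite SE => /imsetP[j Sj ->].
  apply/arith_progP; exists (val j %/ k)%N.
    by rewrite ltnS leq_div2r //; apply: (ltn_ord j).
  by rewrite -mulrnA mulnC divnK // kdvd.
(* A divisor too large to be an index exceeds [m.+1], so it cannot divide this last index, which is
   in [S']. *)
have gcd1' k : (1 < k)%N -> exists2 x, x \in S' & ~~ (k %| val x)%N.
  move=> k1; have [km|km] := ltnP k m.+2.
    have := gcd1 (Ordinal km); rewrite k1 /= => /existsP[x /andP[Sx nx]].
    by exists x.
  exists ord_max => //=; apply/negP => /(dvdn_leq (ltn0Sn m)).
  by rewrite leqNgt km.
have cD : (#|shifted_diffset S' S'| <= #|diffset S S|)%N.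
  pose psi (z : 'I_(m.+1 + m.+1).+1) := e *+ val z - e *+ m.+1.
  have psi_inj : injective psi.
    move=> z t /addIr h; apply: ord_inj; apply: (mulrn_injV e0 _ _ h).
      by move: Lp (ltn_ord z) => /=; card_lia.
    by move: Lp (ltn_ord t) => /=; card_lia.
  rewrite -(card_imset _ psi_inj); apply/subset_leq_card/subsetP.
  move=> _ /imsetP[_ /imset2P[x y Sx Sy ->] ->].
  have -> : psi (shifted_diff x y) = phi x - phi y.
    rewrite /psi /phi /= shifted_diffE mulrnBr; last first.
      by move: (ltn_ord y); card_lia.
    by rewrite mulrnDr addrAC addrK opprD addrACA subrr add0r.
  by move: Sx Sy; rewrite !inE => *; apply: mem_diffset.
have [le|le] := freiman_shifted_diffset S0 Sm gcd1'.
  exists a, e; split=> //; apply: subset_trans sS _.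
  by apply: arith_progS; move: le cD; rewrite cS; card_lia.
by move: le cD small; rewrite cS; card_lia.
Qed.

(** An element [x] of [A] far from the progression of [A'] would make [x - A'] disjoint from
    [A' - A']. With Cauchy-Davenport this yields [3 * #|A'| - 1] differences, too many. *)
Lemma freiman_from_dense_part A A' a e L :
  e != 0 -> (2 * L < #|V|)%N -> A' \subset A -> A' \subset arith_prog a e L.+1 ->
  (#|diffset A A| + 3 < 3 * #|A'|)%N -> (4 * #|diffset A A| < #|V|)%N ->
  exists a' e', e' != 0 /\ A \subset arith_prog a' e' (#|diffset A A| - #|A|).+1.
Proof.
move=> e0 Lp sA sA' small Dp.
have sD : diffset A' A' \subset diffset A A by apply: diffsetS.
have cD := subset_leq_card sD; have cA := subset_leq_card sA.
have A'n : A' != set0 by rewrite -card_gt0; move: small; card_lia.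
have DT : diffset A' A' != setT.
  by apply/eqP=> e1; move: cD Dp; rewrite e1 cardsT; card_lia.
have CD := cauchy_davenport_diff prime_V A'n A'n DT.
have [|a' [e' [e'0 sA1]]] := freiman_in_short_prog e0 Lp sA'.
  by move: small cD; card_lia.
move: sA1; set l := (_ - _)%N => sA1.
(* The progression of [A'] is extended by [l] terms on each side. Since [#|A'|] exceeds a third of
   [#|A - A|], one has [6 * l < 4 * #|A - A| < #|V|], so rectification still applies. *)
apply: (@freiman_in_short_prog _ (a' - e' *+ l) e' (3 * l)) => //; first 1 last.
- apply/subsetP=> x Ax; apply: contraT => nx.
  have sU : diffset [set x] A' :|: diffset A' A' \subset diffset A A.
    by rewrite subUset sD andbT diffsetS // sub1set.
  have dU : diffset [set x] A' :&: diffset A' A' = set0.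
    apply/setP=> z; rewrite [RHS]inE; apply/negP.
    case/setIP=> /diffsetP[_ /set1P-> [y Ay ->]] /diffsetP[y1 Ay1 [y2 Ay2 xE]].
    case/negP: nx.
    have /arith_progP[j jl jE] := subsetP sA1 _ Ay.
    have /arith_progP[j1 jl1 jE1] := subsetP sA1 _ Ay1.
    have /arith_progP[j2 jl2 jE2] := subsetP sA1 _ Ay2.
    apply/arith_progP; exists (j + j1 + (l - j2))%N.
      by move: jl jl1 jl2; card_lia.
    rewrite !mulrnDr (mulrnBr _ (_ : j2 <= l)%N) //.
    have -> : x = y1 - y2 + y by rewrite -xE subrK.
    have cancel (b u v w t : V) :
        b + u - (b + v) + (b + w) = b - t + (w + u + (t - v)).
      rewrite [RHS]addrACA addKr opprD [b + u + _]addrACA subrr add0r.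
      by rewrite [LHS]addrC !addrA.
    by rewrite jE jE1 jE2; apply: cancel.
  have := cardsUI (diffset [set x] A') (diffset A' A'); rewrite dU cards0.
  have : (#|A'| <= #|diffset [set x] A'|)%N.
    by apply: card_diffset_ge_r; rewrite -card_gt0 cards1.
  by move: (subset_leq_card sU) CD small; card_lia.
- by move: cA small; card_lia.
by rewrite /l; move: cD small Dp; card_lia.
Qed.

End PrimeOrder.

(** * Autocorrelations and energy inequalities *)

Lemma cauchy_schwarz_sum (R : realFieldType) (I : finType) (a b : I -> R) :
  (\sum_i a i * b i) ^+ 2 <= (\sum_i a i ^+ 2) * (\sum_i b i ^+ 2).
Proof.
set P := \sum_i a i ^+ 2; set Q := \sum_i a i * b i; set S := \sum_i b i ^+ 2.
have S0 : 0 <= S by apply: sumr_ge0 => i _; apply: sqr_ge0.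
have key : 0 <= S * (P * S - Q ^+ 2).
  have -> : S * (P * S - Q ^+ 2) = \sum_i (S * a i - Q * b i) ^+ 2.
    transitivity (\sum_i (S ^+ 2 * a i ^+ 2
                 + (- (2 * S * Q) * (a i * b i) + Q ^+ 2 * b i ^+ 2))).
      by rewrite !big_split /= -!mulr_sumr -/P -/Q -/S; ring.
    by apply: eq_bigr => i _; ring.
  by apply: sumr_ge0 => i _; apply: sqr_ge0.
have [S1|S1] := ltP 0 S; first by rewrite -subr_ge0; rewrite pmulr_rge0 in key.
have S00 : S = 0 by apply/eqP; rewrite eq_le S1.
have b0 i : b i = 0.
  apply/eqP; rewrite -sqrf_eq0; apply/eqP.
  by have /psumr_eq0P := S00; apply=> // j _; apply: sqr_ge0.
rewrite /Q big1 ?expr0n /= ?S00 ?mulr0 // => i _.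
by rewrite b0 mulr0.
Qed.

Lemma sum_translate (R : nmodType) (V : finZmodType) (F : V -> R) (c : V) :
  \sum_x F (c + x) = \sum_x F x.
Proof.
by rewrite [RHS](reindex_inj (h := fun x => c + x)) //; apply: addrI.
Qed.

Section Energies.
Variables (R : rcfType) (V : finZmodType).
Implicit Types (X A : {set V}).

Definition ind X (x : V) : R := (x \in X)%:R.

Definition autocorr X (x : V) : R := \sum_a ind X a * ind X (a + x).

Lemma indM X x : ind X x * ind X x = ind X x.
Proof. by rewrite /ind -natrM mulnb andbb. Qed.

Lemma sum_ind X : \sum_x ind X x = #|X|%:R.
Proof.
rewrite -sum1_card natr_sum [RHS]big_mkcond; apply: eq_bigr => x _.
by rewrite /ind; case: (x \in X).
Qed.

Lemma autocorrE X x : autocorr X x = #|[set a in X | a + x \in X]|%:R.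
Proof.
rewrite /autocorr -sum_ind; apply: eq_bigr => a _.
by rewrite /ind inE -natrM mulnb.
Qed.

Lemma autocorr_ge0 X x : 0 <= autocorr X x.
Proof. by rewrite autocorrE ler0n. Qed.

Lemma autocorr_le X x : autocorr X x <= #|X|%:R.
Proof.
rewrite autocorrE ler_nat subset_leq_card //.
by apply/subsetP=> a; rewrite inE => /andP[].
Qed.

Lemma sum_autocorr X : \sum_x autocorr X x = #|X|%:R ^+ 2.
Proof.
rewrite exchange_big /= expr2 -{1}sum_ind mulr_suml; apply: eq_bigr => a _.
by rewrite -mulr_sumr sum_translate sum_ind.
Qed.

Lemma autocorr_eq0 X x : x \notin diffset X X -> autocorr X x = 0.
Proof.
move=> nx; apply: big1 => a _; rewrite /ind -natrM mulnb.
case: andP => // -[Xa Xax]; case/negP: nx.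
by rewrite -(addKr a x) addrC mem_diffset.
Qed.

Section Fixed.
Variable A : {set V}.
Let D := diffset A A.
Let n : R := #|A|%:R.
Let d : R := #|D|%:R.
Let f := autocorr A.
Let W := \sum_x f x * autocorr D x.
Let E := \sum_x f x ^+ 2.
Let E3 := \sum_x f x ^+ 3.

Let mu u v := \sum_c ind A c * (ind A (c + u) * ind A (c + v)).

(** The left side counts pairs of triples based at [c] and [c']. With [t = c' - c], there are [f t]
    such base pairs, and [f t] choices for each of [u] and [v]. *)
Lemma sum_sqr_triple_corr : \sum_u \sum_v mu u v ^+ 2 = E3.
Proof.
transitivity (\sum_c \sum_c' ind A c * ind A c' *
    (\sum_u ind A (c + u) * ind A (c' + u)) ^+ 2).
  transitivity (\sum_u \sum_v \sum_c \sum_c' ind A c * ind A c' *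
      (ind A (c + u) * ind A (c' + u) * (ind A (c + v) * ind A (c' + v)))).
    apply: eq_bigr => u _; apply: eq_bigr => v _.
    rewrite expr2 /mu mulr_suml; apply: eq_bigr => c _.
    by rewrite mulr_sumr; apply: eq_bigr => c' _; ring.
  under eq_bigr => u _ do rewrite exchange_big.
  rewrite exchange_big; apply: eq_bigr => c _.
  under eq_bigr => u _ do rewrite exchange_big.
  rewrite exchange_big; apply: eq_bigr => c' _.
  rewrite expr2 mulr_suml mulr_sumr; apply: eq_bigr => u _.
  by rewrite mulr_sumr mulr_sumr; apply: eq_bigr => v _; ring.
under eq_bigr => c _ do rewrite -(sum_translate _ c).
rewrite exchange_big; apply: eq_bigr => t _.
rewrite exprS /f [in RHS]/autocorr mulr_suml; apply: eq_bigr => c _.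
congr (_ * _ ^+ 2).
rewrite -/(autocorr A t) /autocorr -[RHS](sum_translate _ c).
by apply: eq_bigr => u _; rewrite -!addrA [t + u]addrC.
Qed.

Lemma sum_triple_corr_diag x : \sum_u mu u (u + x) = n * f x.
Proof.
rewrite exchange_big /n -sum_ind mulr_suml; apply: eq_bigr => c _.
rewrite -mulr_sumr; congr (_ * _).
rewrite /f /autocorr -[RHS](sum_translate _ c).
by apply: eq_bigr => u _; rewrite addrA.
Qed.

Lemma triple_corr_supp u v : mu u v = mu u v * (ind D u * ind D v).
Proof.
have supp w : w \notin D -> forall c, ind A c * ind A (c + w) = 0.
  move=> nw c; rewrite /ind -natrM mulnb; case: andP => // -[Ac Acw].
  by case/negP: nw; rewrite -(addKr c w) addrC mem_diffset.
rewrite [ind D u]/ind [ind D v]/ind.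
have [_|/supp u0] := boolP (u \in D); last first.
  rewrite mul0r mulr0; apply: big1 => c _.
  by rewrite mulrA u0 mul0r.
have [_|/supp v0] := boolP (v \in D); last first.
  rewrite !mulr0; apply: big1 => c _.
  by rewrite mulrCA v0 mulr0.
by rewrite !mulr1.
Qed.

(** These weights on [D * D] are the second vector in the Cauchy-Schwarz step of [energy3_lower],
    the first being [mu]. *)
Lemma sum_sqrt_weights :
  \sum_u \sum_v (ind D u * ind D v * Num.sqrt (f (v - u))) ^+ 2 = W.
Proof.
transitivity (\sum_u \sum_x ind D u * ind D (u + x) * f x).
  apply: eq_bigr => u _; rewrite -[LHS](sum_translate _ u); apply: eq_bigr => x _.
  rewrite [u + x - u]addrC addKr exprMn sqr_sqrtr ?autocorr_ge0 // exprMn !expr2.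
  by rewrite !indM.
rewrite exchange_big; apply: eq_bigr => x _.
by rewrite [in RHS]mulrC /autocorr mulr_suml.
Qed.

(** This is the power mean inequality for the exponent 3/2 on [D]. With [t ^+ 2] the mean of [f] on
    [D] and [y] the square root of [f x], the tangent bound [2 y^3 >= 3 t y^2 - t^3] is summed over
    [D]. *)
Lemma sum_pow32_ge (s := \sum_x f x * Num.sqrt (f x)) : A != set0 ->
  n ^+ 6 <= d * s ^+ 2.
Proof.
move=> An.
have d0 : 0 < d by rewrite ltr0n (leq_trans _ (card_diffset_ge_l A An)) // card_gt0.
have n0 : 0 < n by rewrite ltr0n card_gt0.
pose t := Num.sqrt (n ^+ 2 / d).
have t0 : 0 <= t by apply: sqrtr_ge0.
have t2 : t ^+ 2 = n ^+ 2 / d by rewrite sqr_sqrtr // divr_ge0 ?sqr_ge0 ?ltW.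
have s_ge : d * t ^+ 3 <= s.
  have -> : d * t ^+ 3 =
      \sum_x (ind D x * (t ^+ 3 - 3 / 2 * t ^+ 3) + 3 / 2 * t * f x).
    rewrite big_split /= -mulr_suml -mulr_sumr sum_ind sum_autocorr -/d -/n.
    have -> : n ^+ 2 = t ^+ 2 * d by rewrite t2 divfK // gt_eqF.
    by field.
  apply: ler_sum => x _; rewrite /ind; have [xD|nx] := boolP (x \in D); last first.
    have -> : f x = 0 by apply: autocorr_eq0.
    by rewrite !mul0r !mulr0 addr0.
  set y := Num.sqrt (f x).
  have -> : f x = y ^+ 2 by rewrite sqr_sqrtr ?autocorr_ge0.
  have y0 : 0 <= y by apply: sqrtr_ge0.
  have : 0 <= (y - t) ^+ 2 * (2 * y + t).
    by rewrite mulr_ge0 ?sqr_ge0 // addr_ge0 // mulr_ge0.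
  by rewrite mul1r; nra.
have : (d * t ^+ 3) ^+ 2 <= s ^+ 2.
  by rewrite ler_sqr ?nnegrE // ?(le_trans _ s_ge) // mulr_ge0 ?exprn_ge0 // ltW.
have -> : (d * t ^+ 3) ^+ 2 = d ^+ 2 * (t ^+ 2) ^+ 3 by ring.
rewrite t2 => h.
have -> : n ^+ 6 = d * (d ^+ 2 * (n ^+ 2 / d) ^+ 3) by field; rewrite gt_eqF.
by rewrite ler_pM2l.
Qed.

Lemma energy3_lower : A != set0 -> n ^+ 8 <= d * W * E3.
Proof.
move=> An; set s := \sum_x f x * Num.sqrt (f x).
have CS : (n * s) ^+ 2 <= E3 * W.
  rewrite -sum_sqr_triple_corr -sum_sqrt_weights !pair_bigA /=.
  apply: le_trans (cauchy_schwarz_sum _ _).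
  rewrite -(pair_bigA _ (fun u v =>
    mu u v * (ind D u * ind D v * Num.sqrt (f (v - u))))) /=.
  rewrite le_eqVlt; apply/orP; left; apply/eqP; congr (_ ^+ 2).
  transitivity (\sum_u \sum_x mu u (u + x) * Num.sqrt (f x)).
    rewrite exchange_big /s mulr_sumr; apply: eq_bigr => x _.
    by rewrite -mulr_suml sum_triple_corr_diag mulrA.
  apply: eq_bigr => u _; rewrite -[RHS](sum_translate _ u); apply: eq_bigr => x _.
  by rewrite mulrA -triple_corr_supp [u + x - u]addrC addKr.
have h := sum_pow32_ge An; rewrite -/s in h.
apply: le_trans (_ : d * (n * s) ^+ 2 <= _).
  have -> : n ^+ 8 = n ^+ 2 * n ^+ 6 by ring.
  have -> : d * (n * s) ^+ 2 = n ^+ 2 * (d * s ^+ 2) by ring.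
  by rewrite ler_wpM2l ?sqr_ge0.
have -> : d * W * E3 = d * (E3 * W) by ring.
by rewrite ler_wpM2l ?ler0n.
Qed.

(** On [[0, n]] the cube lies below the quadratic that touches it at [m] and meets it at [n],
    because [(f - m)^2 (n - f) >= 0]; here [m] is the mean of [f] on [D]. *)
Lemma energy3_upper (m := n ^+ 2 / d) : A != set0 ->
  E3 <= n ^+ 6 / d ^+ 2 + (n + 2 * m) * (E - n ^+ 4 / d).
Proof.
move=> An.
have d0 : 0 < d by rewrite ltr0n (leq_trans _ (card_diffset_ge_l A An)) // card_gt0.
have -> : n ^+ 6 / d ^+ 2 + (n + 2 * m) * (E - n ^+ 4 / d) =
   \sum_x (ind D x * (m ^+ 3 - 3 * m ^+ 3 + (n + 2 * m) * m ^+ 2)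
      + ((3 * m ^+ 2 - (n + 2 * m) * 2 * m) * f x + (n + 2 * m) * f x ^+ 2)).
  rewrite !big_split /= -mulr_suml -!mulr_sumr sum_ind sum_autocorr -/d -/n -/E /m.
  by field; rewrite gt_eqF.
apply: ler_sum => x _; rewrite /ind; have [xD|nx] := boolP (x \in D); last first.
  have -> : f x = 0 by apply: autocorr_eq0.
  by rewrite !expr0n /= !mul0r !mulr0 !addr0.
have : 0 <= (f x - m) ^+ 2 * (n - f x).
  by rewrite mulr_ge0 ?sqr_ge0 // subr_ge0 autocorr_le.
by rewrite mul1r; nra.
Qed.

(** With [Ax] the set of [a] in [A] such that [a + x] is in [A], every [u] in [Ax - A] has both [u]
    and [u + x] in [D]. Cauchy-Davenport then bounds [autocorr D x] below by [f x + n - 1] whenever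
    [f x] is nonzero. *)
Lemma katz_koester_lower : prime #|V| -> D != setT -> 
  n ^+ 3 + E - n ^+ 2 <= W.
Proof.
move=> pV DT.
have -> : n ^+ 3 + E - n ^+ 2 = \sum_x f x * (n + f x - 1).
  transitivity (\sum_x ((n - 1) * f x + f x ^+ 2)).
    by rewrite big_split /= -mulr_sumr sum_autocorr -/n -/E; ring.
  by apply: eq_bigr => x _; ring.
apply: ler_sum => x _; rewrite /f !autocorrE.
set Ax := [set a in A | a + x \in A].
have [->|Axn] := eqVneq Ax set0; first by rewrite cards0 !mul0r.
rewrite ler_wpM2l ?ler0n // lerBlDr -natrD -[X in _ + X]/(1%:R) -natrD ler_nat.
have sAx : Ax \subset A by apply/subsetP=> a; rewrite inE => /andP[].
have An : A != set0.
  by apply: contraNneq Axn => A0; rewrite -subset0 -A0.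
have sD : diffset Ax A \subset [set u in D | u + x \in D].
  apply/subsetP=> _ /diffsetP[a Aa [b Ab ->]]; 
  have /andP[Aa' Aax] : (a \in A) && (a + x \in A) by move: Aa; rewrite inE.
  by rewrite inE mem_diffset //= addrAC mem_diffset.
have T1 : diffset Ax A != setT.
  apply: contra DT => /eqP e; rewrite -subTset -e; exact: diffsetS.
have := cauchy_davenport_diff pV Axn An T1.
by move: (subset_leq_card sD); card_lia.
Qed.

End Fixed.
End Energies.

(** * Numerical incompatibility of the energy bounds *)

(** The variables stand for [K = d/n], [nu = 1/n], [al = n/p], [w = W/n^3], [e = E/n^3],
    [q = E3/n^4] and [eta = h/n]. The Fourier bound gives [w / K <= 0.5433], so [e <= 0.413] and
    then [K^2 q <= 1.34]. Hence [w K q] is below 0.73, although it is at least 1. *)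
Lemma normalized_energies_contradiction (R : realFieldType)
    (K nu al w e q : R) (eta := 2 * (K + 3 * nu) / 3 - 1) :
  0 < nu <= 1 -> 0 < al <= 45 / 10000 -> 2 - nu <= K -> K + 3 * nu <= 26 / 10 ->
  0 <= w -> 1 + e - nu <= w -> 1 <= w * K * q ->
  K ^+ 2 * q <= 1 + (K ^+ 2 + 2 * K) * (e - K^-1) ->
  w <= K * (K * al + eta ^+ 2 * (1 - K * al)) -> False.
Proof.
move=> /andP[nu0 nu1] /andP[al0 al1] K2 K3 w0 a c b dd1.
have K1 : 1 <= K by clear -nu1 K2; lra.
have K26 : K <= 26 / 10 by clear -nu0 K3; lra.
have K0 : 0 < K by clear -K1; lra.
have eta0 : 0 <= eta by rewrite /eta; clear -K2 nu0; lra.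
have eta1 : eta <= 22 / 30 by rewrite /eta; clear -K3; lra.
have eta2 : eta ^+ 2 <= 484 / 900.
  have -> : 484 / 900 = (22 / 30) ^+ 2 :> R by field.
  by rewrite ler_sqr ?nnegrE //; clear; lra.
have Ka0 : 0 <= K * al by rewrite mulr_ge0 // ltW.
have Ka : K * al <= 117 / 10000.
  have -> : 117 / 10000 = 26 / 10 * (45 / 10000) :> R by field.
  by rewrite ler_pM // ltW.
have th : K * al + eta ^+ 2 * (1 - K * al) <= 5433 / 10000.
  have : eta ^+ 2 * (1 - K * al) <= 484 / 900 * (1 - K * al).
    by rewrite ler_wpM2r //; clear -Ka; lra.
  by clear -Ka0 Ka; lra.
have wK : w <= 5433 / 10000 * K.
  by apply: le_trans dd1 _; rewrite mulrC ler_wpM2r // ltW.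
have e1 : e <= 413 / 1000 by clear -wK a nu0 K3; lra.
have KV : (K ^+ 2 + 2 * K) * (e - K^-1) = (K ^+ 2 + 2 * K) * e - K - 2.
  by field; rewrite gt_eqF.
have bnd : K ^+ 2 * q <= 134 / 100.
  apply: le_trans b _; rewrite KV.
  have : (K ^+ 2 + 2 * K) * e <= (K ^+ 2 + 2 * K) * (413 / 1000).
    by rewrite ler_wpM2l // addr_ge0 ?sqr_ge0 //; clear -K0; lra.
  have : K ^+ 2 <= 26 / 10 * K by rewrite expr2 ler_wpM2r // ltW.
  by move: ((K ^+ 2 + 2 * K) * e) => z; clear -K26; lra.
have q0 : 0 <= K ^+ 2 * q.
  rewrite mulr_ge0 ?sqr_ge0 // leNgt; apply/negP => q0.
  have : w * K * q <= 0 by rewrite mulr_ge0_le0 // ?mulr_ge0 // ltW.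
  by clear -c; lra.
have : w * K * q <= 5433 / 10000 * (K ^+ 2 * q).
  have -> : w * K * q = w / K * (K ^+ 2 * q) by field; rewrite gt_eqF.
  by rewrite ler_wpM2r // ler_pdivrMr.
by clear -c bnd; lra.
Qed.

Lemma energies_contradiction (R : realFieldType) (n d p W E E3 : R)
    (h := 2 * (d + 3) / 3 - n) :
  0 <= W -> 1 <= n -> 2 * n - 1 <= d -> d + 3 < 26 / 10 * n -> n < 45 / 10000 * p ->
  n ^+ 3 + E - n ^+ 2 <= W -> n ^+ 8 <= d * W * E3 ->
  E3 <= n ^+ 6 / d ^+ 2 + (n + 2 * (n ^+ 2 / d)) * (E - n ^+ 4 / d) ->
  p * W <= n ^+ 2 * d ^+ 2 + h ^+ 2 * (p * d - d ^+ 2) -> False.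
Proof.
move=> W0 n1 dn dK np hW hWE3 hE3 hp.
have n0 : 0 < n by clear -n1; lra.
have d0 : 0 < d by clear -n1 dn; lra.
have p0 : 0 < p by clear -n0 np; lra.
have nn : n != 0 by rewrite gt_eqF.
have dd : d != 0 by rewrite gt_eqF.
have pp : p != 0 by rewrite gt_eqF.
have nun : n^-1 * n = 1 by rewrite mulVf.
apply: (@normalized_energies_contradiction R (d / n) n^-1 (n / p)
          (W / n ^+ 3) (E / n ^+ 3) (E3 / n ^+ 4)).
- by rewrite invr_gt0 n0 invf_le1.
- by rewrite divr_gt0 // ler_pdivrMr // ltW.
- by rewrite ler_pdivlMr // mulrBl nun.
- rewrite -lerBrDr ler_pdivrMr // mulrBl -[3 * n^-1 * n]mulrA nun mulr1.
  by clear -dK; lra.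
- by rewrite divr_ge0 // exprn_ge0 // ltW.
- rewrite ler_pdivlMr ?exprn_gt0 //; apply: le_trans hW.
  by rewrite le_eqVlt; apply/orP; left; apply/eqP; field.
- have -> : W / n ^+ 3 * (d / n) * (E3 / n ^+ 4) = d * W * E3 / n ^+ 8 by field.
  by rewrite ler_pdivlMr ?exprn_gt0 // mul1r.
- have -> : (d / n) ^+ 2 * (E3 / n ^+ 4) = E3 * (d ^+ 2 / n ^+ 6) by field.
  apply: le_trans (ler_wpM2r _ hE3) _; first by rewrite divr_ge0 ?exprn_ge0 // ltW.
  by rewrite le_eqVlt; apply/orP; left; apply/eqP; field; rewrite nn dd.
rewrite ler_pdivrMr ?exprn_gt0 // -(ler_pM2l p0); apply: le_trans hp _.
by rewrite le_eqVlt; apply/orP; left; apply/eqP; rewrite /h; field; rewrite nn pp.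
Qed.

(** * Sinusoids sampled at the vertices of a regular polygon *)

Section RootsOfUnity.
Variable R : realType.

(** A full turn is added to the usual angle so that [phi - pi / 2], a zero of the sinusoid, is
    positive and can be passed by a natural number of steps. *)
Lemma polar_coordinates (a b : R) : exists rho phi : R,
  [/\ 0 <= rho, pi / 2 < phi, a = rho * cos phi & b = rho * sin phi].
Proof.
have pi0 := pi_gt0 R.
pose rho := Num.sqrt (a ^+ 2 + b ^+ 2).
have rho2 : rho ^+ 2 = a ^+ 2 + b ^+ 2.
  by rewrite sqr_sqrtr // addr_ge0 ?sqr_ge0.
have [rho0|rho0] := eqVneq rho 0.
  exists 0, pi; have h : a ^+ 2 + b ^+ 2 = 0 by rewrite -rho2 rho0 expr0n.
  have a2 := sqr_ge0 a; have b2 := sqr_ge0 b.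
  have a0 : a ^+ 2 = 0 by clear -h a2 b2; lra.
  have b0 : b ^+ 2 = 0 by clear -h a2 b2; lra.
  split; rewrite ?mul0r //.
  - by clear -pi0; lra.
  - by apply/eqP; rewrite -sqrf_eq0 a0.
  - by apply/eqP; rewrite -sqrf_eq0 b0.
have ge0 : 0 <= rho by apply: sqrtr_ge0.
pose x := a / rho; pose y := b / rho.
have xy : x ^+ 2 + y ^+ 2 = 1.
  by rewrite !expr_div_n -mulrDl -rho2 divff // expf_neq0.
have x1 : -1 <= x <= 1.
  have x2 : x ^+ 2 <= 1 by have := sqr_ge0 y; clear -xy; lra.
  by apply/andP; split; clear -x2; nra.
have sx : sin (acos x) = `|y|.
  by rewrite sin_acos // -sqrtr_sqr; congr Num.sqrt; rewrite -xy addrC addKr.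
have cx : cos (acos x) = x by case: (acos_def x1).
have /andP[ac0 ac1] : 0 <= acos x <= pi by case: (acos_def x1).
have aE : a = rho * x by rewrite mulrC divfK.
have bE : b = rho * y by rewrite mulrC divfK.
have [y0|y0] := leP 0 y.
  exists rho, (acos x + pi *+ 2).
  split; rewrite ?cosD2pi ?sinD2pi ?cx ?sx ?ger0_norm //.
  by rewrite [pi *+ 2]mulr2n; clear -pi0 ac0; lra.
exists rho, (- acos x + pi *+ 2).
split; rewrite ?cosD2pi ?sinD2pi ?cosN ?sinN ?cx ?sx ?ltr0_norm ?opprK //.
by rewrite [pi *+ 2]mulr2n; clear -pi0 ac1; lra.
Qed.

Definition cos_frac (p k : nat) : R := cos (k%:R * (pi *+ 2 / p%:R)).
Definition sin_frac (p k : nat) : R := sin (k%:R * (pi *+ 2 / p%:R)).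

Section Period.
Variable p : nat.
Hypothesis p_gt0 : (0 < p)%N.

Lemma angle_period (k q : nat) :
  (k + q * p)%:R * (pi *+ 2 / p%:R) = k%:R * (pi *+ 2 / p%:R) + (pi *+ 2) *+ q :> R.
Proof.
rewrite natrD mulrDl natrM -mulrA [p%:R * _]mulrC divfK ?pnatr_eq0 -?lt0n //.
by rewrite [q%:R * _]mulr_natl.
Qed.

Lemma cos_frac_mod k : cos_frac p (k %% p) = cos_frac p k.
Proof.
rewrite [in RHS](divn_eq k p) addnC /cos_frac angle_period.
by rewrite (periodicn (@cosD2pi R)).
Qed.

Lemma sin_frac_mod k : sin_frac p (k %% p) = sin_frac p k.
Proof.
rewrite [in RHS](divn_eq k p) addnC /sin_frac angle_period.
by rewrite (periodicn (@sinD2pi R)).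
Qed.

Lemma cos_fracD j k :
  cos_frac p (j + k) = cos_frac p j * cos_frac p k - sin_frac p j * sin_frac p k.
Proof. by rewrite /cos_frac natrD mulrDl cosD. Qed.

Lemma sin_fracD j k :
  sin_frac p (j + k) = sin_frac p j * cos_frac p k + cos_frac p j * sin_frac p k.
Proof. by rewrite /sin_frac natrD mulrDl sinD. Qed.

Lemma cos_frac0 : cos_frac p 0 = 1.
Proof. by rewrite /cos_frac mul0r cos0. Qed.

Lemma sin_frac0 : sin_frac p 0 = 0.
Proof. by rewrite /sin_frac mul0r sin0. Qed.

Lemma cos_frac1_neq1 : (1 < p)%N -> cos_frac p 1 != 1.
Proof.
move=> p1; rewrite /cos_frac mul1r.
have pi0 := pi_gt0 R.
have h : 0 < pi *+ 2 / (p%:R : R) <= pi.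
  apply/andP; split; first by rewrite divr_gt0 ?ltr0n // -mulr_natr mulr_gt0.
  rewrite ler_pdivrMr ?ltr0n //.
  by rewrite -[pi *+ 2]mulr_natr ler_pM2l // ler_nat.
case/andP: h => h1 h2.
have in0 : 0 \in `[0 : R, pi] by rewrite in_itv /= lexx ltW.
have inw : pi *+ 2 / p%:R \in `[0 : R, pi] by rewrite in_itv /= h2 ltW.
have := ltr_cos in0 inw; rewrite cos0 h1 => lt1.
by rewrite lt_eqF.
Qed.

End Period.

(* The nonnegativity set of a sinusoid sampled at the [p = 2L+1] points of a
   regular polygon is an arc of [L+1] points or the complement of one. *)
Lemma sinusoid_sign_arc (L : nat) (a b : R) (p := (2 * L).+1) :
  exists (u : nat) (eps : R), eps ^+ 2 = 1 /\ forall j, (j < p)%N ->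
    `|a * cos_frac p (u + j) + b * sin_frac p (u + j)|
      = eps * (if (j <= L)%N then 1 else -1) *
        (a * cos_frac p (u + j) + b * sin_frac p (u + j)).
Proof.
have [rho [phi [rho0 phi0 -> ->]]] := polar_coordinates a b.
have pi0 := pi_gt0 R.
pose w : R := pi *+ 2 / p%:R.
have w0 : 0 < w by rewrite divr_gt0 ?ltr0n // -mulr_natr mulr_gt0.
have pw : p%:R * w = 2 * pi by rewrite mulrC divfK ?pnatr_eq0 // mulr_natl.
pose F k : R := cos (k%:R * w - phi).
have FE k : rho * cos phi * cos_frac p k + rho * sin phi * sin_frac p k = rho * F k.
  by rewrite /F cosB /cos_frac /sin_frac -/w; ring.
have exu : exists u, phi - pi / 2 <= u%:R * w.
  exists (Num.bound ((phi - pi / 2) / w)).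
  rewrite -ler_pdivrMr //; apply/ltW/archi_boundP.
  by apply: divr_ge0; rewrite ?subr_ge0; apply: ltW.
case: (ex_minnP exu) => u0 hu0 minu0.
have u0w : u0%:R * w - w < phi - pi / 2.
  case: u0 hu0 minu0 => [|v] hu0 minu0.
    by move: hu0; rewrite mul0r; clear -phi0 w0; lra.
  have : ~~ (phi - pi / 2 <= v%:R * w) by apply/negP=> /minu0; rewrite ltnn.
  have -> : v.+1%:R * w - w = v%:R * w by rewrite -natr1; ring.
  by rewrite -ltNge.
(* [u0] is the first sample at or after the ascending zero and [de] its distance from that zero,
   less than one step. *)
pose de := u0%:R * w - phi + pi / 2.
have de0 : 0 <= de by rewrite /de; clear -hu0; lra.
have de1 : de < w by rewrite /de; clear -u0w; lra.
have FS j : F (u0 + j)%N = sin (de + j%:R * w).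
  by rewrite -cosBpihalf /F natrD /de; congr cos; ring.
have Lw : (2 * L%:R + 1) * w = 2 * pi by rewrite -pw /p -[(2 * L).+1%:R]natr1 natrM.
have Fpos j : (j < L)%N -> 0 <= F (u0 + j)%N.
  move=> jL; rewrite FS sin_ge0_pi //.
  have j0 : 0 <= j%:R * w by rewrite mulr_ge0 ?ler0n // ltW.
  have : (j%:R + 1) * w <= L%:R * w by rewrite ler_pM2r // natr1 ler_nat.
  by move=> h; apply/andP; clear -j0 h Lw de0 de1 w0; split; lra.
have Fneg j : (L < j < p)%N -> F (u0 + j)%N <= 0.
  move=> /andP[Lj jp]; rewrite FS.
  have -> : de + j%:R * w = de + j%:R * w - pi + pi by ring.
  rewrite sinDpi oppr_le0 sin_ge0_pi //.
  have h1 : (L%:R + 1) * w <= j%:R * w by rewrite ler_pM2r // natr1 ler_nat.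
  have : (j%:R + 1) * w <= p%:R * w by rewrite ler_pM2r // natr1 ler_nat.
  by rewrite pw => h2; apply/andP; clear -h1 h2 Lw de0 de1 w0; split; lra.
(* Only the sign at [u0 + L] is undetermined. If it is nonnegative, the nonnegative arc of [L+1]
   points starts at [u0]; otherwise the nonpositive arc of [L+1] points starts at [u0 + L]. *)
have [FL|FL] := leP 0 (F (u0 + L)%N).
  exists u0, 1; split=> [|j jp]; first by rewrite expr1n.
  rewrite FE mul1r; case: leqP => jL.
    rewrite mul1r ger0_norm // mulr_ge0 //.
    by move: jL; rewrite leq_eqVlt => /orP[/eqP->//|/Fpos].
  by rewrite mulN1r ler0_norm // mulr_ge0_le0 // Fneg // jL.
exists (u0 + L)%N, (-1); split=> [|j jp]; first by rewrite sqrrN expr1n.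
rewrite FE; case: leqP => jL.
  rewrite mulr1 mulN1r ler0_norm // mulr_ge0_le0 // -addnA.
  move: jL; rewrite -[j]subn0; case: (posnP j) => [->|j0] jL.
    by rewrite addn0 ltW.
  by apply: Fneg; move: jL j0; rewrite /p; clear; lia.
have -> : F (u0 + L + j)%N = F (u0 + (j - L.+1))%N.
  have -> : (u0 + L + j = u0 + (j - L.+1) + 1 * p)%N.
    by move: jL; rewrite /p; clear; lia.
  by rewrite /F /w angle_period // mulr1n addrAC cosD2pi.
rewrite mulN1r opprK mul1r ger0_norm // mulr_ge0 // Fpos //.
by move: jL jp; rewrite /p; clear; lia.
Qed.

End RootsOfUnity.

(** * Characters and Fourier coefficients *)

(* A character of [V], split into its real part [c] and imaginary part [s]. *)
Record is_character (R : realType) (V : finZmodType) (c s : V -> R) : Prop := {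
  char_cosD : forall x y, c (x + y) = c x * c y - s x * s y;
  char_sinD : forall x y, s (x + y) = s x * c y + c x * s y;
  char_norm : forall x, c x ^+ 2 + s x ^+ 2 = 1 }.

Section Character.
Variables (R : realType) (V : finZmodType) (c s : V -> R).
Hypothesis char_cs : is_character c s.
Let cD := char_cosD char_cs.
Let sD := char_sinD char_cs.
Let cs1 := char_norm char_cs.

(** The squared modulus of the Fourier coefficient of [X]. *)
Definition char_power (c s : V -> R) (X : {set V}) : R :=
  (\sum_x ind R X x * c x) ^+ 2 + (\sum_x ind R X x * s x) ^+ 2.

Lemma char_cosB x t : c x * c (x + t) + s x * s (x + t) = c t.
Proof. by rewrite -[RHS]mul1r -(cs1 x) cD sD; ring. Qed.

Lemma char_sinB x t : c x * s (x + t) - s x * c (x + t) = s t.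
Proof. by rewrite -[RHS]mul1r -(cs1 x) cD sD; ring. Qed.

Lemma char_powerE X : char_power c s X = \sum_t autocorr R X t * c t.
Proof.
rewrite /char_power !expr2 !mulr_suml -big_split /=.
transitivity (\sum_a \sum_t ind R X a * ind R X (a + t) * c t).
  apply: eq_bigr => a _.
  rewrite -[X in _ * X + _](sum_translate _ a) -[X in _ + _ * X](sum_translate _ a).
  rewrite !mulr_sumr -big_split /=; apply: eq_bigr => t _.
  by rewrite -(char_cosB a t); ring.
rewrite exchange_big; apply: eq_bigr => t _.
by rewrite /autocorr mulr_suml.
Qed.

(** This is the imaginary part of a Fourier coefficient times its own conjugate. *)
Lemma sum_autocorr_sin X : \sum_t autocorr R X t * s t = 0.
Proof.
set C := \sum_x ind R X x * c x; set S := \sum_x ind R X x * s x.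
transitivity (C * S - S * C); last by ring.
rewrite {1}/C {2}/S !mulr_suml -sumrB.
transitivity (\sum_a \sum_t ind R X a * ind R X (a + t) * s t).
  rewrite exchange_big; apply: eq_bigr => t _.
  by rewrite /autocorr mulr_suml.
apply: eq_bigr => a _.
rewrite /C /S -[X in _ = _ * X - _](sum_translate _ a).
rewrite -[X in _ = _ - _ * X](sum_translate _ a).
rewrite !mulr_sumr -sumrB /=; apply: eq_bigr => t _.
by rewrite -(char_sinB a t); ring.
Qed.

Lemma char_powerM X Y : char_power c s X * char_power c s Y =
  \sum_t \sum_z autocorr R X t * autocorr R Y (t + z) * c z.
Proof.
transitivity (\sum_t autocorr R X t *
   (c t * (\sum_u autocorr R Y u * c u) + s t * (\sum_u autocorr R Y u * s u))).
  rewrite sum_autocorr_sin -char_powerE [char_power c s X]char_powerE mulr_suml.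
  by apply: eq_bigr => t _; ring.
apply: eq_bigr => t _.
rewrite -[X in c t * X](sum_translate _ t) -[X in s t * X](sum_translate _ t).
rewrite !mulr_sumr -big_split mulr_sumr /=; apply: eq_bigr => z _.
by rewrite -(char_cosB t z); ring.
Qed.

Lemma char_power_ge0 X : 0 <= char_power c s X.
Proof. by rewrite addr_ge0 ?sqr_ge0. Qed.

End Character.

Lemma autocorr0 (R : rcfType) (V : finZmodType) (X : {set V}) :
  autocorr R X 0 = #|X|%:R.
Proof.
by rewrite -(sum_ind R); apply: eq_bigr => x _; rewrite addr0 indM.
Qed.

(* Parseval: the spectral mass of [D] outside the trivial character is
   [p * #|D| - #|D|^2]. *)
Lemma fourier_energy_bound (R : realType) (V : finZmodType)
    (c s : V -> V -> R) (A D : {set V}) (h : R) :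
  (forall y, is_character (c y) (s y)) ->
  (forall x, c 0 x = 1) -> (forall x, s 0 x = 0) ->
  (forall z, \sum_y c y z = if z == 0 then #|V|%:R else 0) ->
  (forall y, y != 0 -> char_power (c y) (s y) A <= h ^+ 2) ->
  #|V|%:R * (\sum_x autocorr R A x * autocorr R D x)
    <= #|A|%:R ^+ 2 * #|D|%:R ^+ 2
       + h ^+ 2 * (#|V|%:R * #|D|%:R - #|D|%:R ^+ 2).
Proof.
move=> chr c0 s0 orth bound.
pose P X y := char_power (c y) (s y) X.
have P0 X : P X 0 = #|X|%:R ^+ 2.
  rewrite /P /char_power.
  under eq_bigr => x _ do rewrite c0 mulr1.
  under [X in _ + X ^+ 2]eq_bigr => x _ do rewrite s0 mulr0.
  by rewrite sum_ind big1_eq expr0n addr0.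
have pars : #|V|%:R * (\sum_x autocorr R A x * autocorr R D x)
    = \sum_y P A y * P D y.
  under [RHS]eq_bigr => y _ do rewrite /P (char_powerM (chr y)).
  rewrite exchange_big mulr_sumr; apply: eq_bigr => t _.
  rewrite exchange_big (bigD1 0) //= [X in _ + X]big1 ?addr0 => [|z z0].
    by rewrite -mulr_sumr orth eqxx ?addr0; ring.
  by rewrite -mulr_sumr orth (negbTE z0) mulr0.
have mass : \sum_y P D y = #|V|%:R * #|D|%:R.
  under eq_bigr => y _ do rewrite /P (char_powerE (chr y)).
  rewrite exchange_big (bigD1 0) //= [X in _ + X]big1 ?addr0 => [|z z0].
    by rewrite -mulr_sumr orth eqxx autocorr0 mulrC.
  by rewrite -mulr_sumr orth (negbTE z0) mulr0.
rewrite pars -mass (bigD1 (0 : V)) //= !P0 lerD2l.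
have -> : \sum_y P D y - #|D|%:R ^+ 2 = \sum_(y | y != 0) P D y.
  by rewrite (bigD1 (0 : V)) //= P0 addrAC subrr add0r.
rewrite mulr_sumr; apply: ler_sum => y y0.
by rewrite ler_wpM2r ?char_power_ge0 // bound.
Qed.

(* Correlating [A] with the sign function of a half arc [J] multiplies the
   Fourier coefficient of [A] by that of [J], whose modulus is the maximum of
   [\sum_u |a c u + b s u|] over unit vectors [(a, b)]. *)
Lemma half_arc_bound (R : realType) (V : finZmodType) (c s : V -> R) (g : V)
    (L : nat) (A : {set V}) (M : R) :
  prime #|V| -> #|V| = (2 * L).+1 -> g != 0 -> is_character c s ->
  (forall k, c (g *+ k) = cos_frac R #|V| k) ->
  (forall k, s (g *+ k) = sin_frac R #|V| k) ->
  (forall u, #|A :&: arith_prog u g L.+1|%:R <= M) ->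
  char_power c s A <= (2 * M - #|A|%:R) ^+ 2.
Proof.
move=> pV VL g0 chr cg sg hM.
have cD := char_cosD chr; have sD := char_sinD chr; have cs1 := char_norm chr.
pose J := arith_prog 0 g L.+1.
pose sgn x : R := 2 * ind R J x - 1.
pose Z1 := \sum_x sgn x * c x; pose Z2 := \sum_x sgn x * s x.
pose A1 := \sum_x ind R A x * c x; pose A2 := \sum_x ind R A x * s x.
pose T u := \sum_x sgn x * ind R A (u + x).
set h := 2 * M - #|A|%:R.
have JE j : (j < #|V|)%N -> (g *+ j \in J) = (j <= L)%N.
  move=> jp; apply/arith_progP/idP => [[i iL]|jL]; last by exists j; rewrite ?add0r.
  by rewrite add0r => /(mulrn_injV pV g0 jp) ->//; move: iL; rewrite VL; clear; lia.
have sgnE j : (j < #|V|)%N -> sgn (g *+ j) = if (j <= L)%N then 1 else -1.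
  by move=> jp; rewrite /sgn /ind JE //; case: leqP => _ /=; ring.
(* Up to a global sign, the sign of the sinusoid is a translate of [sgn]. The sum is thus a linear
   form in [(Z1, Z2)] whose coefficients are [(a, b)] up to an isometry, and Cauchy-Schwarz in the
   plane applies. *)
have arcs a b : (\sum_u `|a * c u + b * s u|) ^+ 2
    <= (a ^+ 2 + b ^+ 2) * (Z1 ^+ 2 + Z2 ^+ 2).
  have [u [eps [eps1 sign]]] := sinusoid_sign_arc L a b.
  pose v := g *+ u.
  have -> : \sum_x `|a * c x + b * s x|
      = eps * ((a * c v + b * s v) * Z1 + (b * c v - a * s v) * Z2).
    rewrite -[LHS](sum_translate _ v) /Z1 /Z2 !mulr_sumr -big_split /= mulr_sumr.
    apply: eq_bigr => x _; have [j jp ->] := mulrn_surjV pV x g0.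
    have := sign j; rewrite -VL => /(_ jp).
    rewrite -cg -sg mulrnDr -/v => ->.
    by rewrite cD sD sgnE //; ring.
  have e : a ^+ 2 + b ^+ 2 = (a * c v + b * s v) ^+ 2 + (b * c v - a * s v) ^+ 2.
    by rewrite -[LHS]mulr1 -(cs1 v); ring.
  rewrite exprMn eps1 mul1r e.
  set p1 := a * c v + _; set p2 := b * c v - _.
  have := sqr_ge0 (p1 * Z2 - p2 * Z1); clear; nra.
have Zpos : 0 < Z1 ^+ 2 + Z2 ^+ 2.
  have := arcs 1 0; rewrite expr1n expr0n addr0 mul1r; apply: lt_le_trans.
  have c0 : c 0 = 1 by rewrite -(mulr0n g) cg cos_frac0.
  rewrite exprn_gt0 // (bigD1 (0 : V)) //= c0 mul1r mul0r addr0 normr1.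
  by rewrite ltr_pwDl // sumr_ge0.
have TE u : T u = 2 * #|A :&: arith_prog u g L.+1|%:R - #|A|%:R.
  rewrite -!(sum_ind R) -(sum_translate (ind R A) u).
  rewrite -(sum_translate (ind R (A :&: _)) u).
  rewrite mulr_sumr -sumrB; apply: eq_bigr => x _.
  have -> : ind R (A :&: arith_prog u g L.+1) (u + x) = ind R J x * ind R A (u + x).
    rewrite /ind -natrM mulnb inE andbC; congr (nat_of_bool (_ && _))%:R.
    apply/arith_progP/arith_progP=> -[i iL e]; exists i => //.
      by rewrite add0r; apply: (addrI u).
    by rewrite e add0r.
  by rewrite /sgn; ring.
(* The upper bound is [hM]. For the lower one, the complement of an arc of [L+1] points fits in
   another such arc, so the first contains at least [#|A| - M] points of [A]. *)
have Tle u : `|T u| <= h.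
  have Mc : (#|A| <= #|A :&: arith_prog u g L.+1|
                    + #|A :&: arith_prog (u + g *+ L.+1)%R g L.+1|)%N.
    rewrite -[leqLHS](cardsID (arith_prog u g L.+1) A) leq_add2l.
    apply/subset_leq_card/subsetP=> x.
    rewrite !inE andbC => /andP[-> /=]; have [j jp xE] := mulrn_surjV pV (x - u) g0.
    have {}xE : x = u + g *+ j by rewrite -xE addrC subrK.
    move=> nx; apply/arith_progP; exists (j - L.+1)%N.
      by move: jp; rewrite VL; clear; lia.
    rewrite -addrA -mulrnDr subnKC //; rewrite ltnNge; apply: contra nx => jL.
    by apply/arith_progP; exists j.
  have m1 : #|A|%:R <= #|A :&: arith_prog u g L.+1|%:R + M.
    apply: le_trans (_ : _ <= #|A :&: arith_prog u g L.+1|%:R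
      + #|A :&: arith_prog (u + g *+ L.+1) g L.+1|%:R) _; last by rewrite lerD2l.
    by rewrite -natrD ler_nat.
  have m2 := hM u.
  rewrite TE ler_norml /h; move: m1 m2; clear.
  by move: #|_ :&: _|%:R #|A|%:R => x y m1 m2; apply/andP; split; lra.
have h0 : 0 <= h by apply: le_trans (Tle 0).
pose B1 := \sum_u T u * c u; pose B2 := \sum_u T u * s u.
have B1E : B1 = A1 * Z1 + A2 * Z2.
  rewrite /B1 /T; under eq_bigr => u _ do rewrite mulr_suml.
  rewrite exchange_big /Z1 /Z2 !mulr_sumr -big_split; apply: eq_bigr => x _ /=.
  rewrite /A1 /A2 -(sum_translate (fun y => ind R A y * c y) x).
  rewrite -(sum_translate (fun y => ind R A y * s y) x) !mulr_suml -big_split.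
  apply: eq_bigr => u _ /=; rewrite -(addrC u x).
  by rewrite -[c u]mulr1 -(cs1 x) cD sD; ring.
have B2E : B2 = A2 * Z1 - A1 * Z2.
  rewrite /B2 /T; under eq_bigr => u _ do rewrite mulr_suml.
  rewrite exchange_big /Z1 /Z2 !mulr_sumr -sumrB; apply: eq_bigr => x _ /=.
  rewrite /A1 /A2 -(sum_translate (fun y => ind R A y * c y) x).
  rewrite -(sum_translate (fun y => ind R A y * s y) x) !mulr_suml -sumrB.
  apply: eq_bigr => u _ /=; rewrite -(addrC u x).
  by rewrite -[s u]mulr1 -(cs1 x) cD sD; ring.
pose N := B1 ^+ 2 + B2 ^+ 2.
have NE : N = char_power c s A * (Z1 ^+ 2 + Z2 ^+ 2).
  by rewrite /N B1E B2E /char_power -/A1 -/A2; ring.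
have N0 : 0 <= N by rewrite addr_ge0 ?sqr_ge0.
(* With [N] the squared modulus of the coefficient of [T], [N <= h * Y] and [arcs] gives
   [Y^2 <= N * (Z1^2 + Z2^2)]; cancelling [N] and then [Z1^2 + Z2^2] proves the bound. *)
pose Y := \sum_u `|B1 * c u + B2 * s u|.
have Y0 : 0 <= Y by apply: sumr_ge0.
have NY : N <= h * Y.
  have -> : N = \sum_u T u * (B1 * c u + B2 * s u).
    transitivity (\sum_u (B1 * (T u * c u) + B2 * (T u * s u))).
      by rewrite big_split /= -!mulr_sumr -/B1 -/B2 -!expr2.
    by apply: eq_bigr => u _ /=; ring.
  rewrite mulr_sumr; apply: ler_sum => u _.
  by apply: le_trans (ler_norm _) _; rewrite normrM ler_wpM2r.
have := arcs B1 B2; rewrite -/N -/Y => YN.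
have NN : N * N <= N * (h ^+ 2 * (Z1 ^+ 2 + Z2 ^+ 2)).
  apply: le_trans (_ : (h * Y) ^+ 2 <= _).
    by rewrite -expr2 ler_sqr ?nnegrE ?mulr_ge0.
  by rewrite exprMn [leRHS]mulrCA ler_wpM2l ?sqr_ge0.
rewrite -(ler_pM2r Zpos) -NE.
have [N1|N1] := ltP 0 N; first by rewrite -(ler_pM2l N1).
by apply: le_trans N1 _; rewrite mulr_ge0 ?sqr_ge0 // ltW.
Qed.

(** With [idx] the discrete logarithm to a fixed nonzero base [e], the character of [y] sends [x] to
    the root of unity of exponent [idx y * idx x]. The generator [g] inverts [idx y] modulo the
    prime. *)
Lemma character_family (R : realType) (V : finZmodType) : prime #|V| ->
  exists c s : V -> V -> R,
  [/\ forall y, is_character (c y) (s y),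
      (forall x, c 0 x = 1) /\ (forall x, s 0 x = 0),
      forall z, \sum_y c y z = if z == 0 then #|V|%:R else 0
    & forall y, y != 0 -> exists g, [/\ g != 0,
        forall k, c y (g *+ k) = cos_frac R #|V| k
      & forall k, s y (g *+ k) = sin_frac R #|V| k]].
Proof.
move=> pV; have p0 := prime_gt0 pV; have p1 := prime_gt1 pV.
have [e e0] : exists e : V, e != 0.
  apply/existsP; rewrite -negb_forall; apply/negP => /forallP all0.
  suff : (#|V| <= 1)%N by rewrite leqNgt p1.
  rewrite -(cards1 (0 : V)) -cardsT; apply/subset_leq_card/subsetP=> x _.
  by have := all0 x; rewrite inE ?negbK.
have idxP x : exists i : 'I_#|V|, x == e *+ i.
  by have [i ip ->] := mulrn_surjV pV x e0; exists (Ordinal ip).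
pose idx x : nat := xchoose (idxP x).
have idxK x : e *+ idx x = x by apply/esym/eqP/(xchooseP (idxP x)).
have idx_mod k : idx (e *+ k) = (k %% #|V|)%N.
  apply: (mulrn_injV pV e0); rewrite ?ltn_ord ?ltn_pmod //.
  by rewrite idxK mulrn_modV.
have idxD x y : idx (x + y) = ((idx x + idx y) %% #|V|)%N.
  by rewrite -idx_mod mulrnDr !idxK.
have idx0 : idx 0 = 0%N by rewrite -(mulr0n e) idx_mod mod0n.
have cM k j : cos_frac R #|V| (k * (j %% #|V|)) = cos_frac R #|V| (k * j).
  by rewrite -cos_frac_mod // modnMmr cos_frac_mod.
have sM k j : sin_frac R #|V| (k * (j %% #|V|)) = sin_frac R #|V| (k * j).
  by rewrite -sin_frac_mod // modnMmr sin_frac_mod.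
pose c y x := cos_frac R #|V| (idx y * idx x).
pose s y x := sin_frac R #|V| (idx y * idx x).
have chr y : is_character (c y) (s y).
  split=> [x z|x z|x]; last exact: cos2Dsin2.
    by rewrite /c idxD cM mulnDr cos_fracD.
  by rewrite /s idxD sM mulnDr sin_fracD.
have dual y : y != 0 -> exists g, [/\ g != 0,
    forall k, c y (g *+ k) = cos_frac R #|V| k
  & forall k, s y (g *+ k) = sin_frac R #|V| k].
  move=> y0; have [k kp ek] := mulrn_surjV pV e y0.
  have yk : ((idx y * k) %% #|V| = 1)%N.
    rewrite -idx_mod mulrnA idxK -ek -[X in idx X]mulr1n idx_mod modn_small //.
  exists (e *+ k); split=> [|j|j].
  - apply/eqP=> ke; move: yk.
    by rewrite mulnC -idx_mod mulrnA ke mul0rn idx0.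
  - rewrite /c -mulrnA idx_mod cM -cos_frac_mod // mulnA -modnMml yk mul1n.
    by rewrite cos_frac_mod.
  - rewrite /s -mulrnA idx_mod sM -sin_frac_mod // mulnA -modnMml yk mul1n.
    by rewrite sin_frac_mod.
have symc y x : c y x = c x y by rewrite /c mulnC.
have syms y x : s y x = s x y by rewrite /s mulnC.
exists c, s; split=> //.
  by split=> x; rewrite /c /s idx0 mul0n ?cos_frac0 ?sin_frac0.
move=> z; have [->|z0] := eqVneq z 0.
  rewrite (eq_bigr (fun=> 1)) ?sumr_const // => y _.
  by rewrite /c idx0 muln0 cos_frac0.
have [g [_ cg sg]] := dual z z0.
(* Translating by [g] rotates the sum by a nontrivial root of unity. *)
set T := \sum_y c y z; pose U := \sum_y s y z.
have Trot : T = c z g * T - s z g * U.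
  rewrite {1}/T -(sum_translate _ g) /T /U !mulr_sumr -sumrB.
  apply: eq_bigr => y _.
  by rewrite symc (char_cosD (chr z)) !(symc z y) !(syms z y).
have Urot : U = s z g * T + c z g * U.
  rewrite {1}/U -(sum_translate _ g) /T /U !mulr_sumr -big_split.
  apply: eq_bigr => y _.
  by rewrite syms (char_sinD (chr z)) !(symc z y) !(syms z y).
have c1 : c z g != 1 by rewrite -(mulr1n g) cg cos_frac1_neq1.
(* Eliminating [U] multiplies [T] by the squared modulus of 1 minus a nontrivial root of unity. *)
have key : T * ((1 - c z g) ^+ 2 + s z g ^+ 2) = 0.
  have e1 : T * (1 - c z g) = - s z g * U by rewrite mulrBr mulr1 {1}Trot; ring.
  have e2 : U * (1 - c z g) = s z g * T by rewrite mulrBr mulr1 {1}Urot; ring.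
  have -> : T * ((1 - c z g) ^+ 2 + s z g ^+ 2)
      = T * (1 - c z g) * (1 - c z g) + s z g * (s z g * T) by ring.
  by rewrite e1 -e2; ring.
apply/eqP; move/eqP: key; rewrite mulf_eq0 => /orP[//|].
rewrite paddr_eq0 ?sqr_ge0 // sqrf_eq0 subr_eq0 eq_sym (negbTE c1).
by [].
Qed.

(** * Combination of the two cases and the final statement *)

Lemma small_difference_set_progression (V : finZmodType) (A : {set V}) :
  prime #|V| -> (2000 * #|A| < 9 * #|V|)%N ->
  (10 * #|diffset A A| + 30 < 26 * #|A|)%N ->
  exists a e, e != 0 /\ A \subset arith_prog a e (#|diffset A A| - #|A|).+1.
Proof.
move=> pV hn hd.
(* Order 2 is excluded because the density bound would make [A] empty. *)
have [L VL] : exists L, #|V| = (2 * L).+1.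
  exists #|V|./2; case: (even_prime pV) => [V2|oddV].
    by move: hn hd V2; card_lia.
  by rewrite -[LHS]odd_double_half oddV mul2n.
have [/existsP[g /existsP[u /andP[g0 big]]]|small] :=
    boolP [exists g, exists u, (g != 0) &&
             (#|diffset A A| + 3 < 3 * #|A :&: arith_prog u g L.+1|)%N].
  apply: (@freiman_from_dense_part V pV A (A :&: arith_prog u g L.+1) u g L) => //.
  - by rewrite VL.
  - exact: subsetIl.
  - exact: subsetIr.
  - by move: hn hd; card_lia.
exfalso.
have An : A != set0 by rewrite -card_gt0; move: hd; card_lia.
have DT : diffset A A != setT.
  by apply/eqP=> e; move: hn hd; rewrite e cardsT; card_lia.
have CD := cauchy_davenport_diff pV An An DT.
pose R : realType := Rdefinitions.R.
have [c [s [chr [c0 s0] orth dual]]] := character_family R pV.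
pose n : R := #|A|%:R; pose d : R := #|diffset A A|%:R; pose p : R := #|V|%:R.
pose h := 2 * (d + 3) / 3 - n.
(* No half arc in any dilation is dense, so [half_arc_bound] applies with [M = (d + 3) / 3]. *)
have bound y : y != 0 -> char_power (c y) (s y) A <= h ^+ 2.
  move=> y0; have [g [g0 cg sg]] := dual y y0.
  have -> : h = 2 * ((d + 3) / 3) - n by rewrite /h mulrA.
  apply: (half_arc_bound pV VL g0 (chr y) cg sg) => u.
  rewrite ler_pdivlMr // mulrC -[d + 3]natrD -natrM ler_nat leqNgt.
  apply: contra small => lt; apply/existsP; exists g; apply/existsP; exists u.
  by rewrite g0.
apply: (@energies_contradiction R n d p
   (\sum_x autocorr R A x * autocorr R (diffset A A) x)
   (\sum_x autocorr R A x ^+ 2) (\sum_x autocorr R A x ^+ 3)).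
- by apply: sumr_ge0 => x _; rewrite mulr_ge0 ?autocorr_ge0.
- by rewrite ler1n card_gt0.
- rewrite lerBlDr -natrM -[1]/(1%:R) -natrD ler_nat.
  by move: CD; card_lia.
- have : 10 * d + 30 < 26 * n by rewrite -!natrM -natrD ltr_nat.
  by clear; lra.
- have : 2000 * n < 9 * p by rewrite -!natrM ltr_nat.
  by clear; lra.
- exact: katz_koester_lower.
- exact: energy3_lower.
- exact: energy3_upper.
- exact: (fourier_energy_bound _ chr c0 s0 orth bound).
Qed.

(* In the conclusion the truncated subtraction on nat is never cut off: the
   second hypothesis forces A to be nonempty, and then #|A| <= #|A - A|. *)
Theorem theorem3 (p : nat) (p_prime : prime p) (A : {set 'F_p})
    (A_small : #|A|%:R < 0.0045%Q * p%:R :> rat)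
    (A_doubling : #|diffset A A|%:R < 2.6%Q * #|A|%:R - 3 :> rat) :
  exists (a d : 'F_p) (n : nat),
    [/\ d != 0,
        (n <= #|diffset A A| - #|A| + 1)%N
      & A \subset arith_prog a d n].
Proof.
have cV : #|'F_p| = p by rewrite card_Fp.
have small : (2000 * #|A| < 9 * #|'F_p|)%N.
  rewrite cV -(ltr_nat rat) !natrM.
  have e : 0.0045%Q = 9 / 2000 :> rat by [].
  by move: A_small; rewrite e; move: (#|A|%:R) (p%:R) => x y; clear; lra.
have doubling : (10 * #|diffset A A| + 30 < 26 * #|A|)%N.
  rewrite -(ltr_nat rat) natrD !natrM.
  have e : 2.6%Q = 26 / 10 :> rat by [].
  move: A_doubling; rewrite e.
  by move: (#|A|%:R) (#|diffset A A|%:R) => x y; clear; lra.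
have [|a [e [e0 sA]]] := small_difference_set_progression _ small doubling.
  by rewrite cV.
by exists a, e, (#|diffset A A| - #|A|).+1; rewrite addn1.
Qed.
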